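(* Assume the generalised Riemann hypothesis. Let $m\ge 3$ be an integer. Then there is a real number $d_m>0$, depending only on $m$, with the following property. Let $$R=\bigcup_{j=1}^{\varphi(m)/2}\left(\overline{a}_{i_j}\cap\mathbb{P}\right)$$ be the union of the primes in any $\frac{\varphi(m)}{2}$ (distinct) of the $\varphi(m)$ residue classes $\overline{a}_1,\ldots,\overline{a}_{\varphi(m)}$ of the reduced residue system modulo $m$, let $a,b\in\mathbb{Z}$ with $b\ne 0$, put $\Lambda(x)=a-bx$, and let $\xi$ be any non-zero integer satisfying $$4|\xi|\prod_{p\in R}|\xi|_p^2<d_m .$$ Then there exists a prime $p\in R$ for which $\Lambda(F_p(\xi))\neq 0$.
   Context: $\mathbb{P}$ denotes the set of all prime numbers and $\varphi$ is Euler's totient function ($\varphi(m)$ is even for $m\ge 3$). The reduced residue system modulo $m$ consists of the classes $\{h+km\mid k\in\mathbb{Z}\}$ with $\gcd(h,m)=1$. The generalised Riemann hypothesis (GRH) is the assertion that for every Dirichlet character $\chi$, all zeros of the Dirichlet $L$-function $L(s,\chi)$ in the strip $0<\operatorname{Re}(s)<1$ lie on the line $\operatorname{Re}(s)=\frac12$. For a prime $p$, $|\cdot|_p$ is the $p$-adic absolute value normalized by $|p|_p=p^{-1}$, and $\mathbb{Q}_p$ is the completion of $\mathbb{Q}$ with respect to it. For $z\in\mathbb{Q}_p$ with $|z|_p\le 1$ the series $F_p(z):=\sum_{n=0}^\infty n!\,z^n$ (Euler's factorial series) converges in $\mathbb{Q}_p$, and $F_p(z)\in\mathbb{Q}_p$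 denotes its sum. *)

(* Defs.v *)
From HB Require Import structures.
From mathcomp Require Import all_boot all_order all_algebra ring_quotient.
From mathcomp Require Import complex.
From mathcomp Require Import all_classical all_reals all_analysis.

Set Implicit Arguments.
Unset Strict Implicit.
Unset Printing Implicit Defensive.

Import Order.TTheory GRing.Theory Num.Theory numFieldNormedType.Exports.

Local Open Scope classical_set_scope.
Local Open Scope ring_scope.
Local Open Scope complex_scope.

Record prime_nat := PrimeNat { prime_val :> nat; prime_valP : prime prime_val }.

HB.instance Definition _ := [isSub for prime_val].
HB.instance Definition _ := [Countable of prime_nat by <:].

Section PadicAbsRat.
Variables (R : realType) (p : prime_nat).
Implicit Types (x y z : rat) (a b : int).

Definition padic_abs_rat x : R :=
  if x == 0 then 0
  else p%:R ^ ((logn p `|denq x|)%:Z - (logn p `|numq x|)%:Z).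

Local Notation nrm := padic_abs_rat.

Lemma prime_natr_gt1 : 1 < p%:R :> R.
Proof. by rewrite ltr1n prime_gt1// prime_valP. Qed.

Lemma prime_natr_gt0 : 0 < p%:R :> R.
Proof. exact: lt_trans ltr01 prime_natr_gt1. Qed.

Lemma padic_abs_rat0 : nrm 0 = 0.
Proof. by rewrite /padic_abs_rat eqxx. Qed.

Lemma padic_abs_rat_gt0 x : x != 0 -> 0 < nrm x.
Proof. by move=> x0; rewrite /padic_abs_rat (negPf x0) exprz_gt0 ?prime_natr_gt0. Qed.

Lemma padic_abs_rat_ge0 x : 0 <= nrm x.
Proof.
by have [->|/padic_abs_rat_gt0/ltW//] := eqVneq x 0; rewrite padic_abs_rat0.
Qed.

Lemma padic_abs_rat_frac a b : a != 0 -> b != 0 ->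
  nrm (a%:~R / b%:~R) = p%:R ^ ((logn p `|b|)%:Z - (logn p `|a|)%:Z).
Proof.
move=> a0 b0; set x := a%:~R / b%:~R.
have x0 : x != 0 by rewrite mulf_neq0 ?invr_eq0 ?intr_eq0.
rewrite /padic_abs_rat (negPf x0); congr (_ ^ _).
have e : (numq x * b = a * denq x)%R.
  apply: (@intr_inj rat); rewrite !rmorphM/=.
  apply/eqP; rewrite -eqr_div ?intr_eq0 ?denq_neq0//.
  by rewrite divq_num_den.
have : logn p (absz (numq x * b)) = logn p (absz (a * denq x)) by rewrite e.
rewrite !abszM !lognM ?absz_gt0 ?denq_neq0 ?numq_eq0//.
move=> /(congr1 Posz); rewrite !PoszD => E.
have -> : (logn p `|denq x|)%:Z =
    (logn p `|numq x|)%:Z + (logn p `|b|)%:Z - (logn p `|a|)%:Z.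
  by rewrite E addrAC subrr add0r.
by rewrite addrAC [_ + (logn p `|b|)%:Z]addrC addrK.
Qed.

Lemma padic_abs_ratM x y : nrm (x * y) = nrm x * nrm y.
Proof.
have [->|x0] := eqVneq x 0; first by rewrite mul0r padic_abs_rat0 mul0r.
have [->|y0] := eqVneq y 0; first by rewrite mulr0 padic_abs_rat0 mulr0.
rewrite -[in LHS](divq_num_den x) -[in LHS](divq_num_den y) mulrACA -invfM.
rewrite -!intrM padic_abs_rat_frac ?mulf_neq0 ?numq_eq0 ?denq_neq0//.
rewrite /padic_abs_rat (negPf x0) (negPf y0) -expfzDr ?gt_eqF ?prime_natr_gt0//.
rewrite !abszM !lognM ?absz_gt0 ?denq_neq0 ?numq_eq0// !PoszD opprD.
by rewrite addrACA.
Qed.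

Lemma padic_abs_rat1 : nrm 1 = 1.
Proof. apply: (mulfI (lt0r_neq0 (padic_abs_rat_gt0 (oner_neq0 _)))).
by rewrite mulr1 -padic_abs_ratM mulr1. Qed.

Lemma padic_abs_ratN x : nrm (- x) = nrm x.
Proof. by rewrite /padic_abs_rat oppr_eq0 numqN denqN abszN. Qed.

Lemma padic_abs_ratV x : nrm x^-1 = (nrm x)^-1.
Proof.
have [->|x0] := eqVneq x 0; first by rewrite invr0 padic_abs_rat0 invr0.
apply: (mulfI (lt0r_neq0 (padic_abs_rat_gt0 x0))).
by rewrite -padic_abs_ratM !divff// ?padic_abs_rat1// gt_eqF// padic_abs_rat_gt0.
Qed.

Lemma padic_abs_int_le1 a : nrm a%:~R <= 1.
Proof.
have [->|a0] := eqVneq a 0; first by rewrite padic_abs_rat0.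
rewrite -[a%:~R]divr1 -[1%R in X in nrm X]/((1%:Z)%:~R) padic_abs_rat_frac//.
rewrite logn1 sub0r -invr_expz invf_le1 ?exprz_gt0 ?prime_natr_gt0//.
by rewrite -exprnP exprn_ege1// ltW// prime_natr_gt1.
Qed.

Lemma padic_abs_int_le k a : (nrm a%:~R <= p%:R ^- k) = (p ^ k %| `|a|)%N.
Proof.
have [->|a0] := eqVneq a 0.
  by rewrite padic_abs_rat0 dvdn0 invr_ge0 exprn_ge0 // ltW// prime_natr_gt0.
rewrite -[a%:~R]divr1 -[1%R in X in nrm X]/((1%:Z)%:~R) padic_abs_rat_frac//.
rewrite logn1 sub0r -invr_expz lef_pV2 ?posrE ?exprz_gt0 ?exprn_gt0 ?prime_natr_gt0//.
by rewrite -exprnP ler_eXn2l ?prime_natr_gt1// pfactor_dvdn ?absz_gt0// prime_valP.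
Qed.

Lemma padic_abs_ratD x y : nrm (x + y) <= Num.max (nrm x) (nrm y).
Proof.
wlog xy : x y / nrm x <= nrm y => [h|].
  have /orP[/h//|/h] := le_total (nrm x) (nrm y).
  by rewrite addrC maxC.
have [y0|y0] := eqVneq y 0.
  by rewrite y0 addr0 padic_abs_rat0 le_max lexx.
suff H z : nrm z <= 1 -> nrm (1 + z) <= 1.
  have -> : x + y = (1 + x / y) * y by rewrite mulrDl mul1r divfK// addrC.
  rewrite padic_abs_ratM le_max; apply/orP; right.
  rewrite ler_piMl ?padic_abs_rat_ge0// H//.
  by rewrite padic_abs_ratM padic_abs_ratV ler_pdivrMr ?padic_abs_rat_gt0// mul1r.
have [->|z0] := eqVneq z 0; first by rewrite addr0 padic_abs_rat1.
move=> z1.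
have pd : ~~ (p %| `|denq z|)%N.
  apply/negP => pd; move: z1; apply/negP; rewrite -ltNge.
  rewrite /padic_abs_rat (negPf z0).
  have -> : logn p `|numq z| = 0%N.
    rewrite lognE; case: and3P => // -[_ _ pn].
    have := coprime_num_den z; rewrite /coprime => /eqP g.
    have : (p %| gcdn `|numq z| `|denq z|)%N by rewrite dvdn_gcd pn pd.
    by rewrite g dvdn1 => /eqP p1; have := prime_valP p; rewrite p1.
  rewrite subr0 -exprnP exprn_egt1 ?prime_natr_gt1// -lt0n logn_gt0.
  by rewrite mem_primes prime_valP pd absz_gt0 denq_neq0.
have -> : 1 + z = (denq z + numq z)%:~R / (denq z)%:~R.
  by rewrite intrD mulrDl divff ?intr_eq0 ?denq_neq0// divq_num_den.
have nd : nrm ((denq z)%:~R^-1) = 1.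
  rewrite -[_^-1]mul1r -[1%R in X in nrm X]/((1%:Z)%:~R).
  rewrite padic_abs_rat_frac ?denq_neq0//.
  by rewrite logn1 subr0 lognE (negPf pd) andbF andbF.
by rewrite padic_abs_ratM nd mulr1 padic_abs_int_le1.
Qed.

Lemma padic_abs_rat_triangle x y : nrm (x + y) <= nrm x + nrm y.
Proof.
apply: le_trans (padic_abs_ratD x y) _; rewrite ge_max.
by rewrite lerDl lerDr !padic_abs_rat_ge0.
Qed.

Lemma padic_abs_rat_dist x y : `|nrm x - nrm y| <= nrm (x - y).
Proof.
have h z w : nrm z - nrm w <= nrm (z - w).
  by rewrite lerBlDr -{1}(subrK w z) padic_abs_rat_triangle.
by rewrite ler_norml h andbT lerNl opprB -(opprB y x) padic_abs_ratN h.
Qed.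

End PadicAbsRat.

Section CauchySequences.
Variables (R : realType) (p : prime_nat).
Local Notation nrm := (padic_abs_rat R p).

Definition padic_cauchy : {pred nat -> rat} := fun u =>
  `[< forall e : R, 0 < e -> exists N, forall i j,
        (N <= i)%N -> (N <= j)%N -> nrm (u i - u j) < e >].

Lemma padic_cauchyP (u : nat -> rat) :
  reflect (forall e : R, 0 < e -> exists N, forall i j,
    (N <= i)%N -> (N <= j)%N -> nrm (u i - u j) < e) (u \in padic_cauchy).
Proof. exact: asboolP. Qed.

Lemma padic_cauchy_bounded u : u \in padic_cauchy ->
  exists2 M : R, 0 < M & forall n, nrm (u n) < M.
Proof.
move=> /padic_cauchyP/(_ 1 ltr01)[N h].
exists (\sum_(i < N.+1) nrm (u i) + 1) => [|n].
  by rewrite ltr_wpDl// sumr_ge0// => i _; rewrite padic_abs_rat_ge0.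
have hs k : (k <= N)%N -> nrm (u k) <= \sum_(i < N.+1) nrm (u i).
  move=> kN; rewrite (bigD1 (inord k))//= inordK// lerDl.
  by rewrite sumr_ge0// => i _; rewrite padic_abs_rat_ge0.
have [nN|/ltnW Nn] := leqP n N.
  by apply: le_lt_trans (hs _ nN) _; rewrite ltrDl.
rewrite -(subrK (u N) (u n)); apply: le_lt_trans (padic_abs_rat_triangle _ _ _ _) _.
by rewrite addrC ler_ltD ?hs ?h.
Qed.

Lemma padic_abs_ratD_lt x y (e : R) : nrm x < e -> nrm y < e -> nrm (x + y) < e.
Proof.
by move=> xe ye; apply: le_lt_trans (padic_abs_ratD _ _ _ _) _; rewrite gt_max xe.
Qed.

Fact padic_cauchy_subring : subring_closed padic_cauchy.
Proof.
split=> [|u v /padic_cauchyP hu /padic_cauchyP hv|u v cu cv].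
- apply/padic_cauchyP => e e0; exists 0%N => i j _ _.
  by rewrite subrr padic_abs_rat0.
- apply/padic_cauchyP => e e0; have [N hN] := hu e e0; have [M hM] := hv e e0.
  exists (maxn N M) => i j; rewrite !geq_max => /andP[Ni Mi] /andP[Nj Mj].
  rewrite -[(u - v) i]/(u i - v i) -[(u - v) j]/(u j - v j) opprB.
  rewrite [v j - u j]addrC addrACA padic_abs_ratD_lt ?hN//.
  by rewrite addrC hM.
- have [Mu Mu0 hMu] := padic_cauchy_bounded cu.
  have [Mv Mv0 hMv] := padic_cauchy_bounded cv.
  move/padic_cauchyP in cu; move/padic_cauchyP in cv.
  apply/padic_cauchyP => e e0.
  have [N hN] := cu _ (divr_gt0 e0 Mv0); have [M hM] := cv _ (divr_gt0 e0 Mu0).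
  exists (maxn N M) => i j; rewrite !geq_max => /andP[Ni Mi] /andP[Nj Mj].
  rewrite -[(u * v) i]/(u i * v i) -[(u * v) j]/(u j * v j).
  have -> : u i * v i - u j * v j = u i * (v i - v j) + (u i - u j) * v j.
    by rewrite mulrBr mulrBl addrA subrK.
  rewrite padic_abs_ratD_lt// padic_abs_ratM.
    rewrite -(divfK (lt0r_neq0 Mu0) e) mulrC.
    by rewrite ltr_pM ?padic_abs_rat_ge0 ?hM.
  rewrite -(divfK (lt0r_neq0 Mv0) e).
  by rewrite ltr_pM ?padic_abs_rat_ge0 ?hN.
Qed.

HB.instance Definition _ :=
  GRing.isSubringClosed.Build (nat -> rat) padic_cauchy padic_cauchy_subring.

Record padic_cauchy_seq := PadicCauchySeq {
  padic_seq :> nat -> rat;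
  padic_seqP : padic_seq \in padic_cauchy }.

HB.instance Definition _ := [isSub for padic_seq].
HB.instance Definition _ := [Choice of padic_cauchy_seq by <:].
HB.instance Definition _ := [SubChoice_isSubComNzRing of padic_cauchy_seq by <:].

Definition padic_null : {pred padic_cauchy_seq} := fun u =>
  `[< nrm (u n) @[n --> \oo] --> 0 >].

Lemma padic_nullP (u : padic_cauchy_seq) :
  reflect (nrm (u n) @[n --> \oo] --> 0) (u \in padic_null).
Proof. exact: asboolP. Qed.

Lemma padic_null_lt (u : padic_cauchy_seq) : u \in padic_null <->
  forall e : R, 0 < e -> exists N, forall i, (N <= i)%N -> nrm (u i) < e.
Proof.
split=> [/padic_nullP/cvgr0Pnorm_lt h e /h[N _ hN]|h].
  by exists N => i /hN; apply: le_lt_trans; rewrite ler_norm.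
apply/padic_nullP/cvgr0Pnorm_lt => e /h[N hN]; exists N => // i /= /hN.
by rewrite ger0_norm ?padic_abs_rat_ge0.
Qed.

Fact padic_null_ideal : idealr_closed padic_null.
Proof.
split=> [||a u v /padic_null_lt hu /padic_null_lt hv].
- by apply/padic_null_lt => e e0; exists 0%N => i _; rewrite padic_abs_rat0.
- apply/negP => /padic_null_lt/(_ 1 ltr01)[N /(_ N (leqnn N))].
  by rewrite padic_abs_rat1 ltxx.
- have [M M0 hM] := padic_cauchy_bounded (padic_seqP a).
  apply/padic_null_lt => e e0.
  have [N hN] := hu _ (divr_gt0 e0 M0); have [K hK] := hv _ e0.
  exists (maxn N K) => i; rewrite geq_max => /andP[Ni Ki].
  rewrite -[(a * u + v) i]/(a i * u i + v i) padic_abs_ratD_lt ?hK//.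
  rewrite padic_abs_ratM -(divfK (lt0r_neq0 M0) e) mulrC.
  by rewrite ltr_pM ?padic_abs_rat_ge0 ?hN.
Qed.

HB.instance Definition _ :=
  isIdealr.Build padic_cauchy_seq padic_null padic_null_ideal.

(* The completion of [rat] for the p-adic absolute value: Cauchy sequences
   modulo null sequences. *)
Definition Qp := {ideal_quot padic_null}.
HB.instance Definition _ := GRing.ComNzRing.on Qp.
HB.instance Definition _ := isPointed.Build Qp 0.

Definition padic_abs (x : Qp) : R := limn (fun n => nrm (repr x n)).

Local Notation piQ := (\pi_Qp%qT : padic_cauchy_seq -> Qp).

Lemma is_cvg_padic_abs_seq (u : padic_cauchy_seq) : cvgn (fun n => nrm (u n)).
Proof.
apply/cauchy_cvgP/cauchy_exP => e e0.
have [N hN] := padic_cauchyP _ (padic_seqP u) e e0.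
exists (nrm (u N)); exists N => // i /= Ni; rewrite /ball/=.
by apply: le_lt_trans (padic_abs_rat_dist _ _ _ _) _; exact: hN.
Qed.

Lemma padic_abs_pi (u : padic_cauchy_seq) : padic_abs (piQ u) = limn (fun n => nrm (u n)).
Proof.
rewrite /padic_abs; set v := repr _.
have /padic_nullP uv : u - v \in padic_null.
  by rewrite Quotient.idealrBE /v reprK.
apply/cvg_lim => //.
have -> : (fun n => nrm (v n)) = (fun n => nrm (u n) - (nrm (u n) - nrm (v n))).
  by apply/funext => n; rewrite opprB addrC subrK.
rewrite -[X in _ --> X]subr0; apply: cvgB; first exact: is_cvg_padic_abs_seq.
apply: norm_cvg0; apply: (squeeze_cvgr _ (cvg_cst 0) uv).
by near=> n; rewrite normr_ge0 padic_abs_rat_dist.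
Unshelve. all: by end_near. Qed.

Lemma cvg_padic_abs (u : padic_cauchy_seq) :
  nrm (u n) @[n --> \oo] --> padic_abs (piQ u).
Proof. by rewrite padic_abs_pi; exact: is_cvg_padic_abs_seq. Qed.

Lemma padic_abs0 : padic_abs 0 = 0.
Proof.
rewrite -(rmorph0 piQ) padic_abs_pi; apply/cvg_lim => //.
by under eq_fun do rewrite padic_abs_rat0; exact: cvg_cst.
Qed.

Lemma padic_abs1 : padic_abs 1 = 1.
Proof.
rewrite -(rmorph1 piQ) padic_abs_pi; apply/cvg_lim => //.
by under eq_fun do rewrite padic_abs_rat1; exact: cvg_cst.
Qed.

Lemma padic_abs_ge0 x : 0 <= padic_abs x.
Proof.
rewrite -[x]reprK padic_abs_pi; apply: limr_ge; first exact: is_cvg_padic_abs_seq.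
by near=> n; exact: padic_abs_rat_ge0.
Unshelve. all: by end_near. Qed.

Lemma padic_abs_eq0 x : padic_abs x = 0 -> x = 0.
Proof.
rewrite -[x]reprK => h; have := @cvg_padic_abs (repr x); rewrite h => /padic_nullP x0.
by rewrite -(rmorph0 piQ); apply/eqP; rewrite -Quotient.idealrBE subr0.
Qed.

Lemma padic_absN x : padic_abs (- x) = padic_abs x.
Proof.
rewrite -[x]reprK -rmorphN !padic_abs_pi; congr (limn _).
by apply/funext => n; exact: padic_abs_ratN.
Qed.

Lemma padic_absM x y : padic_abs (x * y) = padic_abs x * padic_abs y.
Proof.
rewrite -[x]reprK -[y]reprK -rmorphM; set u := repr x; set v := repr y.
rewrite padic_abs_pi; apply/cvg_lim => //.
have -> : (fun n => nrm ((u * v) n)) = (fun n => nrm (u n) * nrm (v n)).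
  by apply/funext => n; exact: padic_abs_ratM.
by apply: cvgM; exact: cvg_padic_abs.
Qed.

Lemma padic_absX x n : padic_abs (x ^+ n) = padic_abs x ^+ n.
Proof.
elim: n => [|n IH]; first by rewrite !expr0 padic_abs1.
by rewrite !exprS padic_absM IH.
Qed.

Lemma padic_absD_le x y (e : R) : padic_abs x < e -> padic_abs y < e ->
  padic_abs (x + y) <= e.
Proof.
rewrite -[x]reprK -[y]reprK -rmorphD; set u := repr x; set v := repr y => xe ye.
have ult := cvgr_lt _ (@cvg_padic_abs u) _ xe.
have vlt := cvgr_lt _ (@cvg_padic_abs v) _ ye.
apply: (cvgr_to_le (@cvg_padic_abs (u + v))).
near=> n; rewrite ltW// padic_abs_ratD_lt//; [near: n; exact: ult|near: n; exact: vlt].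
Unshelve. all: by end_near. Qed.

Lemma padic_absD_max x y : padic_abs (x + y) <= Num.max (padic_abs x) (padic_abs y).
Proof.
apply/ler_addgt0Pl => e e0; apply: padic_absD_le; rewrite ltr_pwDl//.
  by rewrite le_max lexx.
by rewrite le_max lexx orbT.
Qed.

Lemma padic_absD x y : padic_abs (x + y) <= padic_abs x + padic_abs y.
Proof.
apply: le_trans (padic_absD_max _ _) _.
by rewrite ge_max lerDl lerDr !padic_abs_ge0.
Qed.

Fact Qp_inv_ex (x : Qp) : x != 0 -> exists y : Qp, y * x = 1.
Proof.
move=> x0; rewrite -[x]reprK; set u := repr x.
set L := padic_abs x.
have L0 : 0 < L.
  rewrite lt_neqAle padic_abs_ge0 andbT eq_sym.
  by apply: contraNneq x0 => /padic_abs_eq0 ->.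
have ucvg : nrm (u n) @[n --> \oo] --> L.
  by rewrite /L -[x]reprK; exact: cvg_padic_abs.
have L2 : 0 < L / 2 by rewrite divr_gt0.
have L2L : L / 2 < L by rewrite ltr_pdivrMr// mulr_natr mulr2n ltrDl.
have [N _ hN] := cvgr_gt _ ucvg _ L2L.
have u0 n : (N <= n)%N -> u n != 0.
  move=> /hN/=; apply: contraTneq => ->.
  by rewrite padic_abs_rat0 -leNgt ltW.
have cv : (fun n => (u n)^-1) \in padic_cauchy.
  apply/padic_cauchyP => e e0.
  have [M hM] := padic_cauchyP _ (padic_seqP u) _ (mulr_gt0 e0 (mulr_gt0 L2 L2)).
  exists (maxn N M) => i j; rewrite !geq_max => /andP[Ni Mi] /andP[Nj Mj].
  have -> : (u i)^-1 - (u j)^-1 = (u j - u i) / (u i * u j).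
    rewrite invfM mulrBl mulrCA divff ?u0// mulr1.
    by rewrite mulrA divff ?u0// mul1r.
  have uij : u i * u j != 0 by rewrite mulf_neq0 ?u0.
  rewrite padic_abs_ratM padic_abs_ratV ltr_pdivrMr ?padic_abs_rat_gt0//.
  apply: lt_le_trans (hM _ _ Mj Mi) _; rewrite ler_pM2l// padic_abs_ratM.
  by rewrite ler_pM ?(ltW L2)// ltW//; [exact: hN Ni|exact: hN Nj].
pose v := PadicCauchySeq cv; exists (piQ v).
rewrite -rmorphM -(rmorph1 piQ); apply/eqP; rewrite -Quotient.idealrBE.
apply/padic_null_lt => e e0; exists N => i Ni.
by rewrite -[(v * u - 1) i]/((u i)^-1 * u i - 1) mulVf ?u0//.
Qed.

Let inv (x : Qp) : Qp := xget 0 [set y | y * x = 1].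

Fact Qp_mulVf x : x != 0 -> inv x * x = 1.
Proof. by move=> /Qp_inv_ex/(xgetPex 0). Qed.

Fact Qp_invr0 : inv 0 = 0.
Proof.
rewrite /inv; case: xgetP => // y _ /= /eqP.
by rewrite mulr0 eq_sym oner_eq0.
Qed.

HB.instance Definition _ := GRing.ComNzRing_isField.Build Qp Qp_mulVf Qp_invr0.

Fact padic_cauchy_cst (q : rat) : (fun=> q) \in padic_cauchy.
Proof.
apply/padic_cauchyP => e e0; exists 0%N => i j _ _.
by rewrite subrr padic_abs_rat0.
Qed.

Definition padic_of_rat (q : rat) : Qp := piQ (PadicCauchySeq (padic_cauchy_cst q)).

Lemma padic_of_rat_is_zmod_morphism : zmod_morphism padic_of_rat.
Proof.
by move=> a b; rewrite /padic_of_rat -rmorphB; congr (piQ _); exact/val_inj.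
Qed.

Lemma padic_of_rat_is_monoid_morphism : monoid_morphism padic_of_rat.
Proof.
split=> [|a b]; rewrite /padic_of_rat.
  by rewrite -(rmorph1 piQ); congr (piQ _); exact/val_inj.
by rewrite -rmorphM; congr (piQ _); exact/val_inj.
Qed.

HB.instance Definition _ := GRing.isZmodMorphism.Build rat Qp padic_of_rat
  padic_of_rat_is_zmod_morphism.
HB.instance Definition _ := GRing.isMonoidMorphism.Build rat Qp padic_of_rat
  padic_of_rat_is_monoid_morphism.

Lemma padic_abs_of_rat q : padic_abs (padic_of_rat q) = nrm q.
Proof. by rewrite padic_abs_pi; apply/cvg_lim => //; exact: (cvg_cst (nrm q)). Qed.

Lemma padic_abs_pi_cst (u : padic_cauchy_seq) N (e : R) :
  (forall i, (N <= i)%N -> nrm (u i - u N) < e) ->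
  padic_abs (piQ u - padic_of_rat (u N)) <= e.
Proof.
move=> h; rewrite /padic_of_rat -rmorphB.
apply: (cvgr_to_le (@cvg_padic_abs _)).
by exists N => // i /h/ltW.
Qed.

Lemma padic_of_rat_dense x (e : R) : 0 < e ->
  exists q : rat, padic_abs (x - padic_of_rat q) <= e.
Proof.
move=> e0; have [N hN] := padic_cauchyP _ (padic_seqP (repr x)) e e0.
exists (repr x N); rewrite -[x in x - _]reprK; apply: padic_abs_pi_cst => i Ni.
exact: hN.
Qed.

Let dist (x y : Qp) := padic_abs (x - y).
Fact Qp_distxx x : dist x x = 0.
Proof. by rewrite /dist subrr padic_abs0. Qed.
Fact Qp_dist_pos x y : dist x y = 0 -> x = y.
Proof. by move/padic_abs_eq0/eqP; rewrite subr_eq0 => /eqP. Qed.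
Fact Qp_dist_sym x y : dist x y = dist y x.
Proof. by rewrite /dist -padic_absN opprB. Qed.
Fact Qp_dist_triangle y x z : dist x z <= dist x y + dist y z.
Proof. by rewrite /dist -(subrKA y) padic_absD. Qed.

HB.instance Definition _ :=
  isMetric.Build R Qp Qp_distxx Qp_dist_pos Qp_dist_sym Qp_dist_triangle.

Lemma Qp_ballE (x y : Qp) (e : R) : ball x e y = (padic_abs (x - y) < e).
Proof. by rewrite ballEmdist. Qed.

Fact Qp_complete (F : set_system Qp) : ProperFilter F -> cauchy F -> cvg F.
Proof.
move=> FF /cauchyP Fc.
have dn0 n : 0 < n.+1%:R^-1 :> R by rewrite invr_gt0.
have /choice[q hq] n : exists q : rat, F (ball (padic_of_rat q) n.+1%:R^-1).
  have e0 : 0 < n.+1%:R^-1 / 2 :> R by rewrite divr_gt0.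
  have [x Fx] := Fc _ e0.
  have [q hq] := padic_of_rat_dense x (divr_gt0 e0 (@ltr0Sn R 1)).
  exists q; apply: filterS Fx => y; rewrite !Qp_ballE => xy.
  rewrite -(subrKA x) [ltRHS]splitr; apply: le_lt_trans (padic_absD _ _) _.
  rewrite ler_ltD// -padic_absN opprB; apply: le_trans hq _.
  by rewrite ler_piMr ?invf_le1 ?ler1n ?(ltW e0).
have archi (e : R) : 0 < e -> exists N, forall n, (N <= n)%N -> n.+1%:R^-1 < e.
  move=> e0; have [N _ hN] := near_infty_natSinv_lt (PosNum e0).
  by exists N => n /hN.
have cq : q \in padic_cauchy.
  apply/padic_cauchyP => e /archi[N hN]; exists N => i j /hN ie /hN je.
  have [y [yi yj]] := filter_ex (filterI (hq i) (hq j)).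
  rewrite -padic_abs_of_rat rmorphB -(subrKA y).
  apply: le_lt_trans (padic_absD_max _ _) _; rewrite gt_max.
  rewrite !Qp_ballE in yi yj.
  by rewrite (lt_trans yi ie)/= -padic_absN opprB (lt_trans yj je).
apply/cvg_ex; exists (piQ (PadicCauchySeq cq)).
apply/fcvg_ballP => e e0; have e2 : 0 < e / 2 by rewrite divr_gt0.
have [N hN] := archi _ e2; have [M hM] := padic_cauchyP _ cq _ e2.
have K := hq (maxn N M); apply: filterS K => y; rewrite !Qp_ballE => qy.
rewrite -(subrKA (padic_of_rat (q (maxn N M)))) [ltRHS]splitr.
apply: le_lt_trans (padic_absD _ _) _; rewrite ler_ltD//.
  apply: padic_abs_pi_cst => i; rewrite geq_max => /andP[_ Mi].
  by rewrite hM// leq_maxr.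
by apply: lt_trans qy (hN _ _); rewrite leq_maxl.
Qed.

HB.instance Definition _ := Uniform_isComplete.Build Qp Qp_complete.

(* The sum exists whenever [padic_abs z <= 1], see [is_cvg_euler_series]. *)
Definition euler_series (z : Qp) : Qp :=
  limn (series (fun n => (n`!)%:R * z ^+ n)).

Lemma padic_abs_int (a : int) : padic_abs (a%:~R : Qp) = nrm a%:~R.
Proof. by rewrite -padic_abs_of_rat rmorph_int. Qed.

Lemma expn_dvdn_fact k n : (p * k <= n)%N -> (p ^ k %| n`!)%N.
Proof.
have H a b : (a`! * b`! %| (a + b)`!)%N.
  by rewrite -(@bin_fact (a + b) a) ?leq_addr// addKn dvdn_mull.
have H0 : (p ^ k %| (p * k)`!)%N.
  elim: k => [|k IH]; first by rewrite expn0 dvd1n.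
  rewrite mulnS expnS; apply: dvdn_trans (H _ _); apply: dvdn_mul => //.
  by rewrite dvdn_fact// leqnn prime_gt0 ?prime_valP.
move=> /subnKC <-; apply: dvdn_trans (H _ _); exact: dvdn_mulr.
Qed.

Lemma is_cvg_euler_series (z : Qp) : padic_abs z <= 1 ->
  cvgn (series (fun n => (n`!)%:R * z ^+ n)).
Proof.
move=> z1; apply/cauchy_cvgP/cauchy_exP => e e0.
have [k hk] : exists k, p%:R ^- k < e :> R.
  have [k _ hk] : \forall k \near \oo, (p%:R^-1) ^+ k < e :> R.
    have pV : `|p%:R^-1| < 1 :> R.
      by rewrite ger0_norm ?invr_ge0 ?ler0n// invf_lt1 ?prime_natr_gt0 ?prime_natr_gt1.
    exact: (cvgr_lt _ (cvg_expr pV) _ e0).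
  by exists k; have := hk k (leqnn k); rewrite /= exprVn.
exists (series (fun n => (n`!)%:R * z ^+ n) (p * k)%N).
exists (p * k)%N => // n /= kn; rewrite Qp_ballE -padic_absN opprB.
rewrite sub_series_geq// big_nat; elim/big_ind: _ => [|x y xe ye|i /andP[ki _]].
- by rewrite padic_abs0.
- by apply: le_lt_trans (padic_absD_max _ _) _; rewrite gt_max xe.
- rewrite padic_absM padic_absX; apply: le_lt_trans hk.
  apply: (@le_trans _ _ (padic_abs (i`!)%:R)).
    by rewrite ler_piMr ?padic_abs_ge0 ?exprn_ile1 ?padic_abs_ge0.
  by rewrite (padic_abs_int (i`!)%:Z) padic_abs_int_le expn_dvdn_fact.
Qed.

End CauchySequences.

Lemma padic_abs_int_finite_support (R : realType) (A : set prime_nat)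
    (xi : int) : xi != 0 ->
  finite_set (A `&` [set p | padic_abs_rat R p xi%:~R ^+ 2 != 1]).
Proof.
move=> xi0.
apply: (@sub_finite_set _ _ [set p : prime_nat | (p < (absz xi).+1)%N]).
  move=> p [_ /=]; apply: contraNT; rewrite ltnNge negbK => xip.
  rewrite -[xi%:~R]divr1 -[1%R in X in padic_abs_rat _ _ X]/((1%:Z)%:~R).
  rewrite padic_abs_rat_frac// logn1 sub0r lognE.
  case: and3P => [[_ _ /dvdn_leq]|_]; last by rewrite oppr0 expr0z expr1n.
  by rewrite absz_gt0 => /(_ xi0); rewrite leqNgt xip.
apply: (@finite_preimage _ _ (`I_(absz xi).+1) (prime_val : prime_nat -> nat)).
  by move=> p q _ _; exact: val_inj.
exact: finite_II.
Qed.

Definition linear_form (K : pzRingType) (a b : int) (x : K) : K :=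
  a%:~R - b%:~R * x.

Definition residue_class (m h : nat) : set int :=
  range (fun k : int => h%:Z + k * m%:Z).

Definition residue_primes (m : nat) (H : {set 'I_m}) : set prime_nat :=
  \bigcup_(h in [set` H]) [set p : prime_nat | residue_class m h (p : nat)%:Z].

Section GRH.
Variable R : realType.

Definition dirichlet_character (q : nat) (chi : int -> R[i]) : Prop :=
  [/\ (0 < q)%N,
      forall a b : int, chi (a * b) = chi a * chi b,
      forall a : int, chi (a + q%:Z) = chi a &
      forall a : int, (chi a != 0) = coprimez a q%:Z].

(* [n ^ s] for a positive natural number [n] and a complex exponent [s], since
   the library has no complex exponential. *)
Definition natpowC (n : nat) (s : R[i]) : R[i] :=
  ((n%:R `^ complex.Re s) * cos (complex.Im s * ln n%:R))
  +i* ((n%:R `^ complex.Re s) * sin (complex.Im s * ln n%:R)).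

(* [L] is the analytic continuation of the Dirichlet series of [chi]. By the
   identity theorem this determines [L] except at its possible pole [1], where
   the value of [L] is unconstrained. Differentiability at [s] is complex since
   the scalars of [R[i]^o] are [R[i]]. *)
Definition dirichlet_L (chi : int -> R[i]) (L : R[i]^o -> R[i]^o) : Prop :=
  (forall s : R[i]^o, s != 1 -> derivable L s 1) /\
  (forall s : R[i]^o, 1 < complex.Re s ->
    series (fun n => chi n.+1%:Z * natpowC n.+1 (- s) : R[i]^o) @ \oo --> L s).

Definition generalised_riemann_hypothesis : Prop :=
  forall (q : nat) (chi : int -> R[i]) (L : R[i]^o -> R[i]^o),
    dirichlet_character q chi -> dirichlet_L chi L ->
    forall s : R[i]^o, 0 < complex.Re s < 1 -> L s = 0 -> complex.Re s = 1 / 2.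

End GRH.

(* Main.v *)
(** Let [Q n], [P n] be the Pade approximants of [\sum_k k! t ^ k]: the series
    [Q n * F - P n] has integer coefficients divisible by [n! ^ 2] and starts
    at [t ^ (2 n)].  If [a = b F_p(xi)] for all [p] in [R], then the integer
    [W = b (P n)(xi) - a (Q n)(xi)] is divisible by the [R]-part of
    [n! ^ 2 xi ^ (2 n)], whereas [|W| <= K 16 ^ n n! |xi| ^ n]; and [W] is
    nonzero for [n] or [n + 1], because the determinant
    [Q n * P (n + 1) - Q (n + 1) * P n] is the monomial [n! ^ 2 t ^ (2 n)].
    As [R] takes half of the residue classes, Mertens' theorem in arithmetic
    progressions gives [n! <= C ^ n (n!)_R ^ 2], and the two bounds on [W] are
    incompatible for large [n] as soon as [|xi|] is small compared with
    [xi_R ^ 2].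

    Mertens' theorem for a nonprincipal character [chi] follows from
    [L(1, chi) <> 0]: the sum of [chi(d) Lambda(d) / d] for [d <= n] is bounded
    if [L(1, chi) <> 0], and is [- ln n + O(1)] otherwise.  For [chi ^ 2]
    nonprincipal the second case contradicts [3 + 4 cos t + cos (2 t) >= 0];
    for [chi] real it contradicts the divergence at [x = 1] of
    [\sum_n chi(n) x ^ n / (1 - x ^ n)] (Monsky's argument). *)

Require Import Defs.
From HB Require Import structures.
From mathcomp Require Import all_boot all_order all_algebra.
From mathcomp Require Import complex.
From mathcomp Require Import all_classical all_reals all_analysis.
From mathcomp Require Import ring lra zify.
From mathcomp Require cyclic separable cyclotomic.

Set Implicit Arguments.
Unset Strict Implicit.
Unset Printing Implicit Defensive.

Import Order.TTheory GRing.Theory Num.Theory numFieldNormedType.Exports.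

Local Open Scope classical_set_scope.
Local Open Scope ring_scope.

(** * Pade approximation of Euler's factorial series *)

(** Pascal's rule; it drives the induction for [sum_alt_bin]. *)
Lemma sum_alt_binS (A : pzRingType) n (g : nat -> A) :
  \sum_(i < n.+2) (-1) ^+ i * 'C(n.+1, i)%:R * g i =
  \sum_(i < n.+1) (-1) ^+ i * 'C(n, i)%:R * g i -
  \sum_(i < n.+1) (-1) ^+ i * 'C(n, i)%:R * g i.+1.
Proof.
rewrite big_ord_recl/= bin0 expr0 !mul1r.
under eq_bigr => i _.
  rewrite /bump/= add1n binS natrD mulrDr mulrDl.
  over.
rewrite big_split/= addrA; congr (_ + _).
  rewrite [in RHS]big_ord_recl/= bin0 expr0 !mul1r; congr (_ + _).
  rewrite big_ord_recr/= bin_small// mulr0 mul0r addr0.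
  by apply: eq_bigr => i _.
rewrite -sumrN; apply: eq_bigr => i _.
by rewrite exprS mulN1r !mulNr.
Qed.

(** An [n]-th finite difference of [x -> 'C(x, r)]: by Pascal's rule each difference lowers [r] by
    one, and the result vanishes once [r < n]. *)
Lemma sum_alt_bin n s r :
  \sum_(i < n.+1) (-1) ^+ i * 'C(n, i)%:R * ('C(s + (n - i), r))%:R =
  (if (n <= r)%N then 'C(s, r - n) else 0%N)%:R :> int.
Proof.
elim: n s => [|n IH] s.
  by rewrite big_ord1 bin0 expr0 !mul1r addn0 subn0.
rewrite (@sum_alt_binS int n (fun i => ('C(s + (n.+1 - i), r))%:R)).
under eq_bigr => i _.
  rewrite subSn -?addSnnS; last by rewrite -ltnS.
  over.
rewrite IH.
under eq_bigr => i _ do rewrite subSS.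
rewrite IH; case: ltngtP => [nr|nr|<-]; last 2 first.
- by rewrite subrr.
- by rewrite subnn !bin0 subrr.
have -> : (r - n = (r - n.+1).+1)%N by rewrite -subSn.
by rewrite binS natrD addrAC subrr add0r.
Qed.

(** Up to the sign [(-1) ^ n], this is [n! t ^ n L_n(1 / t)] for the Laguerre polynomial [L_n]. *)
Definition pade_den n : {poly int} :=
  \poly_(i < n.+1) ((-1) ^+ i * ('C(n, i) ^ 2 * i`!)%N%:Z).

(** Truncation keeps the computations in [{poly int}]; [M] stays free so that it can be taken as
    large as the p-adic precision demands. *)
Definition euler_trunc M : {poly int} := \poly_(k < M) (k`!)%:Z.

Definition pade_num n : {poly int} :=
  take_poly n (pade_den n * euler_trunc n).

(** Written with binomials, the convolution is [n! (N - n)!] times the sum of [sum_alt_bin] with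
    [s = r = N - n]. It vanishes for [n <= N < 2 n], which is the Pade property. *)
Lemma coef_pade_prod n N M : (n <= N)%N -> (N < M)%N ->
  (pade_den n * euler_trunc M)`_N = (n`! * (N - n)`! * 'C(N - n, n))%N%:Z.
Proof.
move=> nN NM; rewrite coefM.
have -> : \sum_(i < N.+1) (pade_den n)`_i * (euler_trunc M)`_(N - i) =
    \sum_(i < n.+1) (-1) ^+ i * ('C(n, i) ^ 2 * i`!)%N%:Z * ((N - i)`!)%:Z.
  rewrite (big_ord_widen _ (fun i => (-1) ^+ i * ('C(n, i) ^ 2 * i`!)%N%:Z * ((N - i)`!)%:Z)
    (_ : n < N.+1)%N)// [RHS]big_mkcond/=.
  apply: eq_bigr => i _; rewrite !coef_poly (leq_ltn_trans (leq_subr _ _) NM).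
  by case: ifP; rewrite ?mul0r.
have := sum_alt_bin n (N - n) (N - n).
have -> : (if (n <= N - n)%N then 'C(N - n, N - n - n) else 0%N) = 'C(N - n, n).
  by case: leqP => [h|h]; [rewrite bin_sub|rewrite bin_small].
rewrite natz !PoszM => <-; rewrite mulr_sumr; apply: eq_bigr => i _.
have iN : (i <= n)%N by rewrite -ltnS.
have e1 := bin_fact iN.
have ->: (N - n + (n - i) = N - i)%N by lia.
have : (N - n <= N - i)%N by rewrite leq_sub2l.
move=> /bin_fact.
have ->: (N - i - (N - n) = n - i)%N by lia.
move=> e2.
rewrite -e2 -e1 expnS expn1 !PoszM !natz; ring.
Qed.

Lemma pade_den_size n : (size (pade_den n) <= n.+1)%N.
Proof. exact: size_poly. Qed.

Lemma pade_num_size n : (size (pade_num n) <= n)%N.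
Proof. exact: size_take_poly. Qed.

Lemma dvdn_fact2 n k : (2 * n <= k)%N -> (n`! ^ 2 %| k`!)%N.
Proof.
move=> nk; apply: (@dvdn_trans (2 * n)`!); last first.
  by rewrite -(bin_fact nk) mulnCA dvdn_mulr.
have h : (n <= 2 * n)%N by lia.
rewrite -(bin_fact h); have -> : (2 * n - n = n)%N by lia.
by rewrite mulnn dvdn_mull.
Qed.

Lemma coef_pade_rem n N M : (N < 2 * n)%N -> (2 * n <= M)%N ->
  (pade_den n * euler_trunc M - pade_num n)`_N = 0.
Proof.
move=> Nn nM; rewrite coefB /pade_num coef_take_poly.
case: ltnP => h; last by rewrite subr0 coef_pade_prod ?bin_small ?muln0//; lia.
rewrite !coefM -sumrB big1// => i _.
have iN := ltn_ord i; rewrite !coef_poly.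
have -> : (N - i < M)%N by lia.
have -> : (N - i < n)%N by lia.
by rewrite subrr.
Qed.

Lemma coef_pade_rem_lead n M : (2 * n < M)%N ->
  (pade_den n * euler_trunc M - pade_num n)`_(2 * n) = (n`! ^ 2)%N%:Z.
Proof.
move=> nM; rewrite coefB /pade_num coef_take_poly ifF ?subr0; last by lia.
rewrite coef_pade_prod; [|lia|lia].
by rewrite (_ : 2 * n - n = n)%N ?binn ?muln1 ?mulnn//; lia.
Qed.

Lemma coef_pade_rem_dvd n N M : (3 * n <= M)%N ->
  ((n`! ^ 2)%N %| (pade_den n * euler_trunc M - pade_num n)`_N)%Z.
Proof.
move=> nM; have [Nn|nN] := ltnP N (2 * n).
  by rewrite coef_pade_rem ?dvdz0//; lia.
rewrite coefB /pade_num coef_take_poly ifF ?subr0; last by lia.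
have [NM|MN] := ltnP N M.
  rewrite coef_pade_prod//; last by lia.
  have h : (n <= N - n)%N by lia.
  rewrite dvdzE/=.
  have := bin_fact h; move: ('C(N - n, n)) => c <-.
  rewrite (_ : (n`! * (c * (n`! * (N - n - n)`!)) * c =
    n`! ^ 2 * (c * (N - n - n)`! * c))%N); first exact: dvdn_mulr.
  by rewrite -mulnn; ring.
rewrite coefM; apply: rpred_sum => i _.
rewrite /pade_den /euler_trunc !coef_poly.
case: ltnP => [h1|_]; last by rewrite mul0r dvdz0.
case: ltnP => [h2|_]; last by rewrite mulr0 dvdz0.
apply: dvdz_mull; rewrite dvdzE/=; apply: dvdn_fact2; lia.
Qed.

Lemma pade_rem_horner n M (x : int) : (3 * n <= M)%N ->
  ((n`! ^ 2)%N%:Z * x ^+ (2 * n) %|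
    (pade_den n).[x] * (euler_trunc M).[x] - (pade_num n).[x])%Z.
Proof.
move=> nM; rewrite -hornerM -hornerN -hornerD horner_coef.
apply: rpred_sum => i _; have [Nn|nN] := ltnP i (2 * n).
  by rewrite coef_pade_rem ?mul0r ?dvdz0//; lia.
rewrite dvdz_mul ?coef_pade_rem_dvd// -(subnK nN) exprD.
exact: dvdz_mull.
Qed.

(** Degree against order of vanishing: the left side has degree at most [2 n], while, as a
    combination of the two Pade remainders, it has no coefficient below [2 n]. [M] is just large
    enough for the remainders to be controlled up to degree [2 n]. *)
Lemma pade_det n : pade_den n * pade_num n.+1 - pade_den n.+1 * pade_num n =
  (n`! ^ 2)%N%:Z *: 'X^(2 * n).
Proof.
pose M := (2 * n).+2.
have e : pade_den n * pade_num n.+1 - pade_den n.+1 * pade_num n =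
    pade_den n.+1 * (pade_den n * euler_trunc M - pade_num n) -
    pade_den n * (pade_den n.+1 * euler_trunc M - pade_num n.+1) by ring.
apply/polyP => N; rewrite coefZ coefXn.
have [Nn|nN] := ltnP (2 * n) N.
  rewrite gtn_eqF// mulr0; apply: nth_default; apply: leq_trans (size_polyD _ _) _.
  rewrite size_polyN geq_max; apply/andP; split;
    apply: leq_trans (size_polyMleq _ _) _;
    have := pade_den_size n; have := pade_den_size n.+1;
    have := pade_num_size n; have := pade_num_size n.+1;
    move: (size (pade_den n)) (size (pade_den n.+1)) (size (pade_num n))
      (size (pade_num n.+1)) => ? ? ? ?; lia.
rewrite e coefB [X in _ - X]coefM [X in _ - X]big1 ?subr0; last first.
  move=> i _; have iN := ltn_ord i; rewrite (@coef_pade_rem n.+1) ?mulr0//; rewrite /M; lia.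
rewrite coefM big_ord_recl/= big1 ?addr0; last first.
  move=> i _; have iN := ltn_ord i; rewrite (@coef_pade_rem n) ?mulr0//; rewrite /bump /M; lia.
rewrite subn0 (_ : (pade_den n.+1)`_0 = 1) ?mul1r; last by rewrite coef_poly/= bin0.
move: nN; rewrite leq_eqVlt => /orP[/eqP->|h].
  by rewrite eqxx mulr1 coef_pade_rem_lead// /M; lia.
by rewrite (ltn_eqF h) mulr0 coef_pade_rem// /M; lia.
Qed.

Lemma leq_bin_exp2 n i : ('C(n, i) <= 2 ^ n)%N.
Proof.
have [ni|ni] := leqP i n; last by rewrite bin_small.
rewrite -[2%N]/(1 + 1)%N expnDn (bigD1 (Ordinal (_ : i < n.+1)%N))//=.
by rewrite !exp1n !muln1 leq_addr.
Qed.

Lemma leq_sqr_exp4 n : (n ^ 2 <= 4 ^ n)%N.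
Proof. by rewrite -[4%N]/(2 ^ 2)%N -expnM mulnC expnM leq_exp2r// ltnW// ltn_expl. Qed.

(** One factor [4 ^ n] bounds the squared binomial coefficients, the other the number [n + 1] of
    terms. *)
Lemma pade_den_bound n (x : int) : x != 0 ->
  (`|(pade_den n).[x]| <= 16 ^ n * n`! * `|x| ^ n)%N.
Proof.
move=> x0; rewrite horner_poly.
apply: (@leq_trans (\sum_(i < n.+1) 4 ^ n * n`! * `|x| ^ n)%N); last first.
  rewrite sum_nat_const card_ord !mulnA !leq_mul//.
  rewrite -[16%N]/(4 * 4)%N expnMn leq_mul//.
  have n4 : (n < 4 ^ n)%N by exact: ltn_expl.
  exact: n4.
elim/big_ind2: _ => // [a b c e h1 h2|i _].
  lia.
rewrite !abszM !abszX/= exp1n mul1n; apply: leq_mul; last first.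
  by rewrite leq_pexp2l ?absz_gt0// -ltnS.
apply: leq_mul; last by apply: leq_fact; rewrite -ltnS.
by rewrite -[4%N]/(2 ^ 2)%N -expnM mulnC expnM leq_exp2r// leq_bin_exp2.
Qed.

(** As for the denominator, now with at most [n ^ 2 <= 4 ^ n] terms and with [j! (i - j)! <= i!]. *)
Lemma pade_num_bound n (x : int) : x != 0 ->
  (`|(pade_num n).[x]| <= 16 ^ n * n`! * `|x| ^ n)%N.
Proof.
move=> x0; rewrite horner_poly.
apply: (@leq_trans (\sum_(i < n) n * (4 ^ n * n`!) * `|x| ^ n)%N); last first.
  rewrite sum_nat_const card_ord !mulnA !leq_mul//.
  by rewrite -[16%N]/(4 * 4)%N expnMn leq_mul// mulnn leq_sqr_exp4.
elim/big_ind2: _ => // [a b c e h1 h2|i _]; first by lia.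
have iN := ltn_ord i.
rewrite abszM abszX; apply: leq_mul; last first.
  by rewrite leq_pexp2l ?absz_gt0// ltnW.
rewrite coefM.
apply: (@leq_trans (\sum_(j < i.+1) 4 ^ n * n`!)%N); last first.
  by rewrite sum_nat_const card_ord leq_mul.
elim/big_ind2: _ => // [a b c e h1 h2|j _]; first by lia.
have jN := ltn_ord j.
rewrite !coef_poly; case: ifP => _; last by rewrite mul0r.
case: ifP => _; last by rewrite mulr0.
rewrite !abszM !abszX/= exp1n mul1n -mulnA leq_mul//.
  by rewrite -[4%N]/(2 ^ 2)%N -expnM mulnC expnM leq_exp2r// leq_bin_exp2.
have ji : (j <= i)%N by [].
apply: (@leq_trans i`!); last exact/leq_fact/ltnW.
by rewrite -(bin_fact ji) leq_pmull ?bin_gt0.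
Qed.

(** * Divisibility, nonvanishing and size of the Pade form *)

Section PadicContradiction.
Variables (R : realType) (p : prime_nat).

Lemma series_euler_trunc (x : int) M :
  series (fun n => (n`!)%:R * (x%:~R : Qp R p) ^+ n) M = (euler_trunc M).[x]%:~R.
Proof.
rewrite /series/= big_mkord horner_poly rmorph_sum/=; apply: eq_bigr => i _.
by rewrite rmorphM rmorphXn/=.
Qed.

Lemma padic_int_le1 (x : int) : padic_abs (x%:~R : Qp R p) <= 1.
Proof. by rewrite padic_abs_int padic_abs_int_le1. Qed.

Lemma euler_trunc_cvg (x : int) k : exists M0, forall M, (M0 <= M)%N ->
  padic_abs ((euler_trunc M).[x]%:~R - euler_series (x%:~R : Qp R p)) <= p%:R ^- k.
Proof.
have /cvg_ballP h := is_cvg_euler_series (padic_int_le1 x).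
have e0 : 0 < p%:R ^- k :> R by rewrite invr_gt0 exprn_gt0// prime_natr_gt0.
have [N _ hN] := h _ e0.
exists N => M /hN/=; rewrite Qp_ballE series_euler_trunc => /ltW.
by rewrite -padic_absN opprB.
Qed.

Lemma padic_absB_le (x y : Qp R p) (e : R) :
  padic_abs x <= e -> padic_abs y <= e -> padic_abs (x - y) <= e.
Proof.
move=> xe ye; apply: le_trans (padic_absD_max _ _) _.
by rewrite ge_max padic_absN xe ye.
Qed.

Lemma padic_absM_int_le (x : int) (y : Qp R p) (e : R) :
  padic_abs y <= e -> padic_abs (x%:~R * y) <= e.
Proof.
move=> ye; rewrite padic_absM; apply: le_trans ye.
by rewrite ler_piMl ?padic_abs_ge0 ?padic_int_le1.
Qed.

(** Substituting [a = b F] splits the form into a multiple of the truncation error of [F] and a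
    multiple of the Pade remainder [E]; both are p-adically at most [p ^- k]. *)
Lemma pade_form_dvd (a b x : int) n : x != 0 ->
  linear_form a b (euler_series (x%:~R : Qp R p)) = 0 ->
  (p ^ logn p (n`! ^ 2 * `|x| ^ (2 * n)) %|
    `|(b * (pade_num n).[x] - a * (pade_den n).[x])%R|)%N.
Proof.
move=> x0; set F := euler_series _; rewrite /linear_form => /eqP.
rewrite subr_eq0 => /eqP aF; set k := logn _ _.
rewrite -(@padic_abs_int_le R) -padic_abs_int.
have [M0 hM0] := euler_trunc_cvg x k.
(* [M0] makes the truncation error at most [p ^- k]; [3 * n] is required by the divisibility of the
   Pade remainder. *)
pose M := maxn M0 (3 * n); have {hM0}hM := hM0 M (leq_maxl _ _).
have hE := pade_rem_horner x (leq_maxr M0 (3 * n)); rewrite -/M in hE.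
set E := _ - _ in hE.
have {}hE : padic_abs (E%:~R : Qp R p) <= p%:R ^- k.
  rewrite padic_abs_int padic_abs_int_le.
  move: hE; rewrite dvdzE abszM abszX; apply: dvdn_trans.
  by rewrite pfactor_dvdn ?prime_valP// muln_gt0 !expn_gt0 fact_gt0 absz_gt0 x0.
have -> : ((b * (pade_num n).[x] - a * (pade_den n).[x])%:~R : Qp R p) =
    (b * (pade_den n).[x])%:~R * ((euler_trunc M).[x]%:~R - F) - b%:~R * E%:~R.
  by rewrite /E !rmorphB !rmorphM/= aF; ring.
by apply: padic_absB_le; apply: padic_absM_int_le.
Qed.

End PadicContradiction.

Lemma pade_form_neq0 (a b x : int) n : b != 0 -> x != 0 ->
  exists2 k, (n <= k)%N & b * (pade_num k).[x] - a * (pade_den k).[x] != 0.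
Proof.
move=> b0 x0.
have [e0|] := eqVneq (b * (pade_num n).[x] - a * (pade_den n).[x]) 0;
  last by exists n.
exists n.+1 => //; apply/eqP => e1.
have := congr1 (fun q => q.[x]) (pade_det n).
rewrite hornerZ hornerXn !hornerE => /(congr1 ( *%R b)).
have -> : b * ((pade_den n).[x] * (pade_num n.+1).[x] -
               (pade_den n.+1).[x] * (pade_num n).[x]) =
    (pade_den n).[x] * (b * (pade_num n.+1).[x] - a * (pade_den n.+1).[x]) -
    (pade_den n.+1).[x] * (b * (pade_num n).[x] - a * (pade_den n).[x]) by ring.
rewrite e0 e1 !mulr0 subrr => /esym/eqP.
rewrite !mulf_eq0 (negPf b0) expf_eq0 (negPf x0) andbF orbF/=.
by rewrite eqz_nat expn_eq0 eqn0Ngt fact_gt0.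
Qed.

Lemma pade_form_bound (a b x : int) n : x != 0 ->
  (`|(b * (pade_num n).[x] - a * (pade_den n).[x])%R| <=
    (`|a|%N + `|b|%N) * (16 ^ n * n`! * `|x| ^ n))%N.
Proof.
move=> x0; have h1 := pade_num_bound n x0; have h2 := pade_den_bound n x0.
apply: (@leq_trans (`|(b * (pade_num n).[x])%R| + `|(a * (pade_den n).[x])%R|)%N); first by lia.
by rewrite !abszM mulnDl addnC leq_add// leq_mul.
Qed.

(** The divisibilities at the single primes of [pi] assemble into divisibility by the whole
    [pi]-part, and a nonzero integer is at least as large as its divisors. *)
Lemma part_le_pade_form (R : realType) (pi : nat_pred) (a b x : int) :
  b != 0 -> x != 0 ->
  (forall p : prime_nat, (p : nat) \in pi ->
    linear_form a b (euler_series (x%:~R : Qp R p)) = 0) ->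
  forall n, exists2 k, (n <= k)%N &
    (k`!`_pi ^ 2 * ((absz x)`_pi ^ 2) ^ k <=
      (`|a|%N + `|b|%N) * (16 ^ k * k`! * `|x| ^ k))%N.
Proof.
move=> b0 x0 h n; have [k nk W0] := pade_form_neq0 a n b0 x0; exists k => //.
apply: leq_trans (pade_form_bound _ _ _ x0).
apply: dvdn_leq; first by rewrite absz_gt0.
have N0 : (0 < k`! ^ 2 * `|x| ^ (2 * k))%N.
  by rewrite muln_gt0 !expn_gt0 fact_gt0 absz_gt0 x0.
have -> : (k`!`_pi ^ 2 * ((absz x)`_pi ^ 2) ^ k = (k`! ^ 2 * `|x| ^ (2 * k))`_pi)%N.
  by rewrite partnM ?expn_gt0 ?fact_gt0 ?absz_gt0 ?x0// !partnX expnM.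
apply/dvdn_partP => [//|p]; rewrite pi_of_part// => /andP[].
rewrite !inE mem_primes => /and3P[pp _ _] ppi.
rewrite partn_part; last by move=> q; rewrite inE => /eqP ->.
by rewrite p_part; exact: (@pade_form_dvd R (PrimeNat pp) a b x k x0 (h (PrimeNat pp) ppi)).
Qed.

Lemma fsbig_padic_abs_sqr (R : realType) (A : set prime_nat) (pi : nat_pred)
    (x : int) : x != 0 -> (forall p, A p <-> (p : nat) \in pi) ->
  \big[*%R/1]_(p \in A) (padic_abs_rat R p x%:~R ^+ 2) = (((absz x)`_pi)%N%:R ^+ 2)^-1.
Proof.
move=> x0 Api.
have e (p : prime_nat) :
    padic_abs_rat R p x%:~R ^+ 2 = ((p ^ logn p `|x|)%:R ^+ 2)^-1.
  rewrite -[x%:~R]divr1 -[1%R in X in padic_abs_rat _ _ X]/((1%:Z)%:~R).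
  by rewrite padic_abs_rat_frac// logn1 sub0r -invr_expz -exprnP natrX exprVn.
(* Primes above [|x|] contribute the factor 1, so this finite list carries the whole product. *)
pose r := pmap (insub : nat -> option prime_nat) (index_iota 0 `|x|.+1).
have rE (p : prime_nat) : (p \in r) = (p < `|x|.+1)%N.
  by rewrite mem_pmap_sub mem_index_iota.
have ru : uniq [seq p : prime_nat <- r | (p : nat) \in pi].
  by rewrite filter_uniq// pmap_sub_uniq// iota_uniq.
rewrite (@fsbigE _ _ _ _ _ _ _ ru)/=; last 2 first.
- by move=> p /=; rewrite mem_filter => /andP[/Api].
- move=> p /Api ppi; rewrite mem_filter ppi/= rE -leqNgt => xp.
  rewrite e lognE; case: and3P => [[_ _ /dvdn_leq]|_]; last by rewrite expn0 expr1n invr1.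
  by rewrite absz_gt0 => /(_ x0); rewrite leqNgt xp.
rewrite big_filter_cond.
under eq_bigl => p.
  rewrite (_ : (p \in A) = ((p : nat) \in pi)); last first.
    by apply/idP/idP; [rewrite inE => /Api|move=> ?; rewrite inE; apply/Api].
  rewrite andbb.
  over.
under eq_bigr do rewrite e.
rewrite prodfV prodrXl -natr_prod; congr ((_%:R ^+ 2)^-1).
rewrite /partn big_mkcond [RHS]big_mkcond /r.
elim: (index_iota _ _) => [|q s IH]; first by rewrite !big_nil.
rewrite big_cons/= /oapp; case: insubP => [u qp uq|qp].
  by rewrite big_cons IH -uq.
rewrite IH lognE (_ : prime q = false)/= ?expn0 ?mul1n; last exact/negbTE.
by case: ifP; rewrite ?expn0 ?mul1n.
Qed.

(** * The von Mangoldt function *)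

Lemma sum_multiples (V : nmodType) (x d : nat) (g : nat -> V) : (0 < d)%N ->
  \sum_(1 <= n < x.+1 | (d %| n)%N) g (n %/ d)%N =
  \sum_(1 <= k < (x %/ d).+1) g k.
Proof.
move=> d0; elim: x => [|x IH]; first by rewrite div0n !big_geq.
rewrite big_mkcond big_nat_recr//= -big_mkcond IH divnS//; case: ifP => dx.
  by rewrite dx add1n [RHS]big_nat_recr.
by rewrite add0n addr0.
Qed.

(** The pairs [(d, k)] with [d k <= x] are grouped by [n = d k] on one side and by [d] on the other.
    All convolution identities below are summed this way. *)
Lemma sum_dvd_exchange (V : nmodType) (x : nat) (g : nat -> nat -> V) :
  \sum_(1 <= n < x.+1) \sum_(1 <= d < x.+1 | (d %| n)%N) g d (n %/ d)%N =
  \sum_(1 <= d < x.+1) \sum_(1 <= k < (x %/ d).+1) g d k.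
Proof.
rewrite (exchange_big_dep_nat xpredT)//=; apply: eq_big_nat => d /andP[d0 _].
exact: sum_multiples.
Qed.

Lemma ln_nat_prod (R : realType) (T : Type) (s : seq T) (P : pred T) (F : T -> nat) :
  (forall i, P i -> (0 < F i)%N) ->
  ln (\prod_(i <- s | P i) F i)%N%:R = \sum_(i <- s | P i) ln (F i)%:R :> R.
Proof.
move=> F0; suff [] : (0 < \prod_(i <- s | P i) F i)%N /\
  ln (\prod_(i <- s | P i) F i)%N%:R = \sum_(i <- s | P i) ln (F i)%:R :> R by [].
elim/big_ind2: _ => [|a b c e [a0 ab] [c0 ce]|i Pi]; rewrite ?ln1//.
  by rewrite muln_gt0 a0 c0 natrM lnM ?posrE ?ltr0n// ab ce.
by rewrite F0.
Qed.

Section VonMangoldt.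
Variable R : realType.
Implicit Types (pi : nat_pred) (d n N : nat).

(** Von Mangoldt's function restricted to powers of primes in [pi]. At most one pair [(p, j)]
    contributes; the double sum avoids extracting the prime from [d] and is ready for exchanges of
    summation. *)
Definition vonmangoldt pi d : R :=
  \sum_(0 <= p < d.+1 | prime p && (p \in pi))
    \sum_(1 <= j < d.+1 | (d == p ^ j)%N) ln p%:R.

Local Notation Lam := (vonmangoldt predT).

Lemma ln_nat_ge0 n : 0 <= ln n%:R :> R.
Proof. by case: n => [|n]; [rewrite ln0|rewrite ln_ge0// ler1n]. Qed.

Lemma vonmangoldt_ge0 pi d : 0 <= vonmangoldt pi d.
Proof. by do 2!apply: sumr_ge0 => *; exact: ln_nat_ge0. Qed.

Lemma vonmangoldt_widen pi d N : (0 < d)%N -> (d <= N)%N ->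
  vonmangoldt pi d = \sum_(0 <= p < N.+1 | prime p && (p \in pi))
    \sum_(1 <= j < N.+1 | (d == p ^ j)%N) ln p%:R.
Proof.
move=> d0 dN; rewrite /vonmangoldt.
rewrite (big_nat_widen _ _ N.+1)//= big_mkcond [RHS]big_mkcond/=.
apply: eq_bigr => p _; case: (boolP (prime p && (p \in pi))) => //= /andP[pp _].
rewrite [in RHS]big_mkcond [RHS](big_cat_nat (n:=d.+1))//=.
rewrite [X in _ = _ + X]big_nat_cond [X in _ = _ + X]big1 ?addr0; last first.
  move=> j /andP[/andP[dj _] _]; case: eqP => // dpj.
  by have := ltn_expl j (prime_gt1 pp); rewrite -dpj ltnNge ltnW.
rewrite -big_mkcond/=; case: ltnP => // dp.
rewrite big_nat_cond big1// => j /andP[/andP[j1 _] /eqP dpj].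
move: dp; rewrite dpj ltnNge -{1}(expn1 p) leq_exp2l ?prime_gt1//.
by rewrite j1.
Qed.

Lemma ln_partn pi n N : (0 < n)%N -> (n <= N)%N ->
  ln (n`_pi)%N%:R =
  \sum_(0 <= p < N.+1 | prime p && (p \in pi)) (logn p n)%:R * ln p%:R :> R.
Proof.
move=> n0 nN; rewrite (@widen_partn N)// ln_nat_prod; last first.
  by move=> p _; rewrite expn_gt0; case: p => //=; rewrite lognE.
rewrite big_mkcond [RHS]big_mkcond/=; apply: eq_bigr => p _.
case: (boolP (prime p)) => pp/=; last first.
  by rewrite lognE (negPf pp)/= ln1; case: ifP.
by case: ifP => // _; rewrite natrX lnXn ?ltr0n ?prime_gt0// mulr_natl.
Qed.

(** For a fixed prime [p] the powers [p ^ j] dividing [n] are those with [j <= logn p n], so [ln p]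
    is counted with the multiplicity of [p] in [n]. *)
Lemma sum_vonmangoldt pi n N : (0 < n)%N -> (n <= N)%N ->
  \sum_(1 <= d < N.+1 | (d %| n)%N) vonmangoldt pi d = ln (n`_pi)%N%:R.
Proof.
move=> n0 nN; rewrite (ln_partn _ n0 nN).
transitivity (\sum_(1 <= d < N.+1 | (d %| n)%N)
    \sum_(0 <= p < N.+1 | prime p && (p \in pi))
    \sum_(1 <= j < N.+1 | (d == p ^ j)%N) ln p%:R : R).
  rewrite big_nat_cond [RHS]big_nat_cond; apply: eq_bigr => d /andP[/andP[d0 dN] _].
  exact: vonmangoldt_widen.
rewrite exchange_big/=; apply: eq_bigr => p /andP[pp _].
rewrite (exchange_big_dep xpredT)//=.
rewrite (eq_big_nat _ _ (F2 := fun j => if (j < (logn p n).+1)%N then ln p%:R else 0)); last first.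
  move=> j /andP[j1 jN]; rewrite ltnS -pfactor_dvdn//.
  case: ifP => pjn.
    rewrite big_mkcond (bigD1_seq (p ^ j)%N) ?iota_uniq//=; last first.
      by rewrite mem_index_iota expn_gt0 prime_gt0//= ltnS (leq_trans (dvdn_leq n0 pjn)).
    rewrite pjn eqxx big1 ?addr0// => d /negPf dpj.
    by rewrite dpj andbF.
  rewrite big1// => d /andP[dn /eqP dE]; move: pjn.
  by rewrite -dE dn.
rewrite -big_mkcond/= -(@big_nat_widen _ _ _ _ _ _ xpredT) /=; last first.
  by rewrite ltnS; apply: leq_trans nN; apply: ltnW; apply: ltn_logl.
by rewrite sumr_const_nat subSS subn0 mulr_natl.
Qed.

Lemma vonmangoldt_le_ln d : (0 < d)%N -> Lam d <= ln d%:R.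
Proof.
move=> d0; have := sum_vonmangoldt predT d0 (leqnn d).
rewrite partnT// => <-; rewrite big_mkcond big_nat_recr//= dvdnn lerDr.
by rewrite sumr_ge0// => i _; case: ifP => // _; exact: vonmangoldt_ge0.
Qed.

Lemma ln_fact_partn pi n :
  ln ((n`!)`_pi)%N%:R = \sum_(1 <= d < n.+1) vonmangoldt pi d * (n %/ d)%:R.
Proof.
transitivity (\sum_(1 <= k < n.+1) ln (k`_pi)%N%:R : R).
  elim: n => [|n IH]; first by rewrite big_geq// fact0 partn1 ln1.
  rewrite factS partnM ?fact_gt0// natrM lnM ?posrE ?ltr0n ?part_gt0//.
  by rewrite IH [RHS]big_nat_recr//= addrC.
rewrite (eq_big_nat _ _ (F2 := fun k =>
  \sum_(1 <= d < n.+1 | (d %| k)%N) vonmangoldt pi d)); last first.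
  by move=> k /andP[k0 kn]; rewrite sum_vonmangoldt.
rewrite (sum_dvd_exchange n (fun d _ => vonmangoldt pi d)); apply: eq_bigr => d _.
by rewrite sumr_const_nat subSS subn0 mulr_natr.
Qed.

Lemma ln_fact n : ln (n`!)%:R = \sum_(1 <= d < n.+1) Lam d * (n %/ d)%:R.
Proof. by rewrite -ln_fact_partn partnT ?fact_gt0. Qed.

Definition psi n : R := \sum_(1 <= d < n.+1) Lam d.

(** Chebyshev's argument: in the expansion of [ln 'C(2 n, n)] the weight of [Lam d] is
    [2 n %/ d - 2 (n %/ d)], which is nonnegative, and equal to 1 for [n < d <= 2 n]; and
    ['C(2 n, n) <= 2 ^ (2 n)]. *)
Lemma psi_double n : psi (2 * n) - psi n <= 2 * n%:R.
Proof.
have nn : (n <= 2 * n)%N by lia.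
apply: (@le_trans _ _ (ln ('C(2 * n, n))%:R)); last first.
  apply: (@le_trans _ _ (ln (2 ^ (2 * n))%N%:R)).
    rewrite ler_ln ?posrE ?ltr0n ?bin_gt0 ?expn_gt0// ler_nat.
    rewrite -[(2 ^ _)%N]/((1 + 1) ^ _)%N expnDn.
    rewrite (bigD1 (Ordinal (_ : n < (2 * n).+1)%N))//=.
    by rewrite !exp1n !muln1 leq_addr.
  rewrite natrX lnXn// -[leLHS]mulr_natl natrM ler_piMr//.
  by apply: (le_ln1Dx (x := 1)); lra.
have e : ln ('C(2 * n, n))%:R = ln ((2 * n)`!)%:R - 2 * ln (n`!)%:R :> R.
  rewrite -(bin_fact nn) (_ : 2 * n - n = n)%N; last by lia.
  by rewrite !natrM !lnM ?posrE ?mulr_gt0 ?ltr0n ?bin_gt0 ?fact_gt0//; ring.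
rewrite e !ln_fact /psi (big_cat_nat (n:=n.+1)(p:=(2 * n).+1))//=.
rewrite [X in _ <= X - _](big_cat_nat (n:=n.+1))//= addrAC subrr add0r.
rewrite addrAC ler_wpDl//.
  rewrite mulr_sumr -sumrB big_nat; apply: sumr_ge0 => d /andP[d0 dn].
  rewrite mulrCA -mulrBr mulr_ge0 ?vonmangoldt_ge0// subr_ge0 -natrM ler_nat.
  by rewrite leq_divRL// -mulnA leq_mul2l leq_trunc_div.
apply: ler_sum_nat => d /andP[nd dn].
have -> : (2 * n %/ d)%N = 1%N; last by rewrite mulr1.
apply/eqP; rewrite eqn_leq; apply/andP; split.
  by rewrite -ltnS ltn_divLR; lia.
by rewrite leq_divRL; lia.
Qed.

(** Halving: [psi (2 h)] exceeds [psi h] by at most [2 h], and for odd [n] the one further term is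
    at most [ln n < n]; both fit below [4 n]. *)
Lemma psi_le n : psi n <= 4 * n%:R.
Proof.
have [k] := ubnP n; elim: k n => // k IH n nk.
have [->|n0] := posnP n; first by rewrite /psi big_geq// mulr0.
have [h hn [nE|nE]] : exists2 h, (h < n)%N & n = (2 * h)%N \/ n = (2 * h).+1.
  exists n./2; first by lia.
  by rewrite -{1 3}(odd_double_half n) -mul2n; case: (odd n); [right|left].
  have h0 : 0 <= h%:R :> R by [].
  have := psi_double h; have := IH h (leq_trans hn nk).
  by rewrite nE natrM => ? ?; lra.
have h0 : 0 <= h%:R :> R by [].
have := psi_double h; have := IH h (leq_trans hn nk).
have := vonmangoldt_le_ln (ltn0Sn (2 * h)).
have := ln_sublinear (ltr0Sn R (2 * h)).
have -> : psi n = psi (2 * h) + Lam (2 * h).+1 by rewrite nE /psi big_nat_recr.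
rewrite nE -(addn1 (2 * h)) natrD natrM => ? ? ? ?; lra.
Qed.

(** After multiplication by [n], replacing [n / d] by [n %/ d] costs at most [psi n <= 4 n] and
    leaves [ln n! <= n ln n]. *)
Lemma sum_vonmangoldt_div_le n : (0 < n)%N ->
  \sum_(1 <= d < n.+1) Lam d / d%:R <= ln n%:R + 4.
Proof.
move=> n0; have n0' : 0 < n%:R :> R by rewrite ltr0n.
rewrite -(ler_pM2l n0') mulr_sumr.
apply: (@le_trans _ _ (ln (n`!)%:R + psi n)).
  rewrite ln_fact /psi -big_split/=; apply: ler_sum_nat => d /andP[d0 dn].
  rewrite mulrCA -[X in _ <= _ + X]mulr1 -mulrDr ler_wpM2l ?vonmangoldt_ge0//.
  rewrite ler_pdivrMr ?ltr0n// -(natrD _ _ 1) -natrM ler_nat.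
  by rewrite addn1 ltnW// ltn_ceil.
rewrite mulrDr lerD//; last by rewrite mulrC psi_le.
elim: (n) => [|k IH]; first by rewrite fact0 ln1 mul0r.
rewrite factS natrM lnM ?posrE ?ltr0n ?fact_gt0// -natr1 mulrDl mul1r addrC lerD//.
apply: le_trans IH _; rewrite ler_wpM2l//.
case: (k) => [|j]; first by rewrite natr1 [leLHS]ln0// ln_nat_ge0.
by rewrite ler_ln ?posrE// natr1 ler_nat.
Qed.

Lemma sum_expr_ge2_le (x : R) N : 0 <= x <= 1 / 2 ->
  \sum_(2 <= j < N) x ^+ j <= 2 * x ^+ 2.
Proof.
move=> /andP[x0 x2].
have h M : (1 - x) * (\sum_(2 <= j < M.+2) x ^+ j) = x ^+ 2 - x ^+ M.+2.
  elim: M => [|M IH]; first by rewrite big_geq// mulr0 subrr.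
  by rewrite big_nat_recr//= mulrDr IH [x ^+ M.+3]exprS; ring.
case: N => [|[|M]]; try by rewrite big_geq// mulr_ge0 ?exprn_ge0.
have := h M; have := exprn_ge0 M.+2 x0.
have : 0 <= \sum_(2 <= j < M.+2) x ^+ j by apply: sumr_ge0 => j _; exact: exprn_ge0.
by move: (\sum_(_ <= _ < _) _) (x ^+ M.+2) => S y S0 y0; nra.
Qed.

(* [(ln k + 2) / k] telescopes above [ln k / k ^ 2]. *)
Lemma sum_ln_div_sqr_le N : \sum_(2 <= k < N) ln k%:R / k%:R ^+ 2 <= 2 :> R.
Proof.
have h M : \sum_(2 <= k < M.+2) ln k%:R / k%:R ^+ 2 <=
    2 - (ln M.+1%:R + 2) / M.+1%:R :> R.
  elim: M => [|M IH]; first by rewrite big_geq// ln1; lra.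
  rewrite big_nat_recr//=; apply: le_trans (lerD IH (lexx _)) _.
  set k : R := M.+1%:R.
  have k0 : 0 < k by rewrite ltr0n.
  have k1 : 1 <= k by rewrite ler1n.
  have -> : M.+2%:R = k + 1 :> R by rewrite /k natr1.
  clearbody k => {IH}.
  have lk : ln (k + 1) <= ln k + k^-1.
    have -> : k + 1 = k * (1 + k^-1) by field; rewrite gt_eqF.
    have kV : 0 < k^-1 by rewrite invr_gt0.
    have kV1 : 0 < 1 + k^-1 by lra.
    by rewrite lnM ?posrE// lerD// le_ln1Dx//; apply: lt_trans kV; lra.
  have lk0 : 0 <= ln k by rewrite ln_ge0.
  move: lk lk0; move: (ln k) (ln (k + 1)) => u v lk lk0.
  rewrite -subr_ge0.
  have -> : 2 - (v + 2) / (k + 1) - (2 - (u + 2) / k + v / (k + 1) ^+ 2) =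
    ((k + 1) ^+ 2 * (u + 2) - k * (k + 1) * (v + 2) - k * v) / (k * (k + 1) ^+ 2).
    by field; rewrite ?gt_eqF//; lra.
  rewrite divr_ge0//; last by rewrite mulr_ge0 ?ltW// exprn_gt0//; lra.
  have kv : k * v <= k * u + 1.
    by move: (ler_wpM2l (ltW k0) lk); rewrite mulrDr divff// gt_eqF.
  have k2 : 0 <= k + 2 by lra.
  by have := ler_wpM2l k2 kv; nra.
case: N => [|[|M]]; try by rewrite big_geq.
apply: le_trans (h M) _; rewrite gerBl divr_ge0// addr_ge0// ln_nat_ge0//.
Qed.

(** Only the powers [p ^ j] with [2 <= j] contribute. The geometric series in [j] leaves
    [2 ln p / p ^ 2], which is then summed over all integers [p >= 2]. *)
Lemma sum_vonmangoldt_nonprime_le N :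
  \sum_(1 <= d < N.+1 | ~~ prime d) Lam d / d%:R <= 4.
Proof.
have [->|N0] := posnP N; first by rewrite big_geq.
apply: (@le_trans _ _ (\sum_(0 <= p < N.+1 | prime p)
    \sum_(2 <= j < N.+1) ln p%:R * p%:R^-1 ^+ j)).
  apply: (@le_trans _ _ (\sum_(1 <= d < N.+1 | ~~ prime d)
      \sum_(0 <= p < N.+1 | prime p) \sum_(1 <= j < N.+1 | (d == p ^ j)%N)
        ln p%:R * p%:R^-1 ^+ j)).
    rewrite big_nat_cond [leRHS]big_nat_cond; apply: ler_sum => d /andP[/andP[d0 dN] _].
    rewrite (vonmangoldt_widen _ d0 dN) mulr_suml le_eqVlt; apply/orP; left; apply/eqP.
    apply: eq_big => [p|p _]; first by rewrite andbT.
    rewrite mulr_suml; apply: eq_bigr => j /eqP ->.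
    by rewrite natrX exprVn.
  rewrite exchange_big/=; apply: ler_sum => p pp.
  rewrite (exchange_big_dep xpredT)//= big_ltn// big1 ?add0r; last first.
    by move=> d /andP[+ /eqP]; rewrite expn1 => /[swap] ->; rewrite pp.
  apply: ler_sum => j _.
  have y0 : 0 <= ln p%:R * p%:R^-1 ^+ j :> R.
    by rewrite mulr_ge0 ?ln_nat_ge0// exprn_ge0.
  apply: (@le_trans _ _ (\sum_(1 <= d < N.+1 | d == (p ^ j)%N) ln p%:R * p%:R^-1 ^+ j)).
    rewrite big_mkcond [leRHS]big_mkcond; apply: ler_sum => d _.
    by case: (d == _); rewrite ?andbF ?andbT//; case: (~~ _).
  case: (boolP ((p ^ j)%N \in index_iota 1 N.+1)) => pN.
    by rewrite big_mkcond (bigD1_seq _ pN)/= ?iota_uniq// eqxx big1 ?addr0// => d /negPf->.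
  rewrite big_seq_cond big1// => d /andP[dN /eqP dp].
  by rewrite dp (negPf pN) in dN.
apply: (@le_trans _ _ (\sum_(2 <= p < N.+1) 2 * (ln p%:R / p%:R ^+ 2))).
  have p2 p : prime p -> \sum_(2 <= j < N.+1) ln p%:R * p%:R^-1 ^+ j <=
      2 * (ln p%:R / p%:R ^+ 2) :> R.
    move=> pp; rewrite -mulr_sumr mulrCA ler_wpM2l ?ln_nat_ge0// -exprVn.
    apply: sum_expr_ge2_le; rewrite invr_ge0 ler0n/= div1r lef_pV2 ?posrE//.
      by rewrite ler_nat prime_gt1.
    by rewrite ltr0n prime_gt0.
  rewrite big_mkcond/=; case: N N0 p2 => [//|N] _ p2.
  rewrite big_ltn// [in X in _ + X]big_ltn// (_ : prime 1 = false)// !add0r.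
  apply: ler_sum_nat => p /andP[p2' _].
  case: ifP => [/p2//|_]; rewrite mulr_ge0// divr_ge0 ?ln_nat_ge0// exprn_ge0//.
by rewrite -mulr_sumr; have := sum_ln_div_sqr_le N.+1; lra.
Qed.

End VonMangoldt.

(** * Divisor sums and the Moebius function *)

Lemma big_divisors (V : nmodType) (n N : nat) (g : nat -> V) :
  (0 < n)%N -> (n <= N)%N ->
  \sum_(1 <= d < N.+1 | (d %| n)%N) g d = \sum_(d <- divisors n) g d.
Proof.
move=> n0 nN; rewrite -big_filter; apply: perm_big.
apply: uniq_perm; rewrite ?filter_uniq ?iota_uniq ?divisors_uniq// => d.
rewrite mem_filter mem_index_iota -dvdn_divisors//.
case: (boolP (d %| n)%N) => //= dn.
by rewrite (dvdn_gt0 n0 dn)/= ltnS (leq_trans (dvdn_leq n0 dn)).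
Qed.

(** A divisor of [p n] is either [p] times a divisor of [n], or prime to [p] and then a divisor of
    [n]. This allows induction on one prime factor at a time. *)
Lemma sum_divisors_pM (V : nmodType) (p n : nat) (g : nat -> V) :
  prime p -> (0 < n)%N ->
  \sum_(d <- divisors (p * n)) g d =
  \sum_(d <- divisors n) g (p * d)%N +
  \sum_(d <- divisors n | ~~ (p %| d)%N) g d.
Proof.
move=> pp n0; have p0 := prime_gt0 pp.
have pn0 : (0 < p * n)%N by rewrite muln_gt0 p0.
rewrite (bigID (fun d => p %| d)%N)/=; congr (_ + _).
  rewrite -(big_map (muln p) xpredT)/= -big_filter; apply: perm_big.
  apply: uniq_perm; rewrite ?filter_uniq ?divisors_uniq//.
    rewrite map_inj_uniq ?divisors_uniq// => a b /eqP.
    by rewrite eqn_pmul2l// => /eqP.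
  move=> d; rewrite mem_filter -dvdn_divisors//.
  apply/andP/mapP => [[/dvdnP[e ->]]|[e]].
    rewrite mulnC dvdn_pmul2l// => en; exists e => //.
    by rewrite -dvdn_divisors.
  by rewrite -dvdn_divisors// => en ->; rewrite dvdn_mulr// dvdn_pmul2l.
rewrite -big_filter -[RHS]big_filter; apply: perm_big.
apply: uniq_perm; rewrite ?filter_uniq ?divisors_uniq// => d.
rewrite !mem_filter -!dvdn_divisors//; case: (boolP (p %| d)%N) => //= pd.
by rewrite Gauss_dvdr// coprime_sym prime_coprime.
Qed.

Lemma sum_divisors_coprime_pX (V : nmodType) p n k (g : nat -> V) :
  prime p -> (0 < n)%N -> ~~ (p %| n)%N ->
  \sum_(d <- divisors (p ^ k * n) | ~~ (p %| d)%N) g d = \sum_(d <- divisors n) g d.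
Proof.
move=> pp n0 pn; elim: k => [|j IH].
  rewrite expn0 mul1n big_mkcond/= big_seq [RHS]big_seq; apply: eq_bigr => d.
  rewrite -dvdn_divisors// => dn; rewrite ifT//.
  by apply: contra pn => pd; exact: dvdn_trans dn.
rewrite expnS -mulnA big_mkcond sum_divisors_pM ?muln_gt0 ?expn_gt0 ?(prime_gt0 pp)//=.
rewrite big1 ?add0r; last by move=> d _; rewrite dvdn_mulr.
rewrite -IH big_mkcond [RHS]big_mkcond/=; apply: eq_bigr => d _.
by case: (p %| d)%N.
Qed.

Definition moebius (n : nat) : int :=
  if all (fun p => logn p n <= 1)%N (primes n) then (-1) ^+ size (primes n) else 0.

Lemma moebius_norm n : `|moebius n| <= 1.
Proof. by rewrite /moebius; case: ifP; rewrite ?normrX ?normrN1 ?expr1n ?normr0. Qed.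

Lemma moebius_pM p n : prime p -> (0 < n)%N ->
  moebius (p * n) = if (p %| n)%N then 0 else - moebius n.
Proof.
move=> pp n0; have p0 := prime_gt0 pp.
have memp q : (q \in primes (p * n)) = (q == p) || (q \in primes n).
  by rewrite primesM// (primes_prime pp) inE.
case: ifP => pn.
  rewrite /moebius ifF//; apply/negbTE/allPn; exists p.
    by rewrite memp eqxx.
  by rewrite lognM// (pfactorK 1 pp : logn p p = 1)%N add1n ltnS -ltnNge logn_gt0 mem_primes pp n0.
have lp0 : logn p n = 0%N by rewrite lognE pp n0 pn.
rewrite /moebius.
have -> : size (primes (p * n)) = (size (primes n)).+1.
  rewrite -[RHS]/(size (p :: primes n)); apply: perm_size; apply: uniq_perm.
  - exact: primes_uniq.
  - by rewrite /= primes_uniq mem_primes pp n0 pn.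
  - by move=> q; rewrite memp inE.
have allE : all (fun q => logn q (p * n) <= 1)%N (primes (p * n)) =
    all (fun q => logn q n <= 1)%N (primes n).
  have lE q : q != p -> logn q (p * n) = logn q n.
    move=> qp; rewrite lognM// (_ : logn q p = 0)%N// logn_prime//.
    by rewrite (negPf qp).
  apply/allP/allP => h q.
    move=> qn; rewrite -lE; first by apply: h; rewrite memp qn orbT.
    by apply: contraTneq qn => ->; rewrite mem_primes pp n0 pn.
  rewrite memp; case: eqVneq => [->|qp] /=; last by rewrite lE//; exact: h.
  by rewrite lognM// lp0 addn0 logn_prime// eqxx.
by rewrite allE; case: ifP; rewrite ?oppr0// exprS mulN1r.
Qed.

(** With [n = p k], the contributions of [p d] and of [d] cancel for each divisor [d] of [k] prime
    to [p], and [p d] contributes 0 for the others. *)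
Lemma sum_moebius n : (0 < n)%N ->
  \sum_(d <- divisors n) moebius d = (n == 1)%N%:R.
Proof.
move=> n0; have [->|n1] := eqVneq n 1%N.
  by rewrite (_ : divisors 1 = [:: 1%N])// big_seq1.
have pp : prime (pdiv n) by rewrite pdiv_prime// ltn_neqAle eq_sym n1.
have /dvdnP[k nk] := pdiv_dvd n; rewrite mulnC in nk.
have k0 : (0 < k)%N by move: n0; rewrite nk muln_gt0 => /andP[].
rewrite nk sum_divisors_pM// [in X in _ + X]big_mkcond/= -big_split/=.
rewrite big_seq big1// => d; rewrite -dvdn_divisors// => /(dvdn_gt0 k0) d0.
by rewrite moebius_pM//; case: ifP => _ /=; rewrite ?addr0// addNr.
Qed.

(** * Divisor sums of a real character *)

Section RealCharacterSum.
Variables (R : realDomainType) (X : nat -> R).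
Hypothesis X1 : X 1%N = 1.
Hypothesis XM : forall a b, X (a * b)%N = X a * X b.
Hypothesis X3 : forall a, [|| X a == 0, X a == 1 | X a == -1].

Let A n := \sum_(d <- divisors n) X d.

Let A_pX p n k : prime p -> (0 < n)%N -> ~~ (p %| n)%N ->
  A (p ^ k * n) = (\sum_(i < k.+1) X p ^+ i) * A n.
Proof.
move=> pp n0 pn.
elim: k => [|k IH]; first by rewrite big_ord1 expn0 expr0 mul1n mul1r.
rewrite expnS -mulnA {1}/A sum_divisors_pM ?muln_gt0 ?expn_gt0 ?(prime_gt0 pp)//.
rewrite sum_divisors_coprime_pX//; under eq_bigr do rewrite XM.
rewrite -mulr_sumr -/(A _) IH [in RHS]big_ord_recl/= expr0 mulrDl mul1r addrC.
congr (_ + _); rewrite mulrA; congr (_ * _); rewrite mulr_sumr.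
by apply: eq_bigr => i _; rewrite exprS.
Qed.

Let geom_ge y k : [|| y == 0, y == 1 | y == -1 :> R] ->
  0 <= \sum_(i < k.+1) y ^+ i /\ (~~ odd k -> 1 <= \sum_(i < k.+1) y ^+ i).
Proof.
move=> y3; elim: k => [|k [IH1 IH2]]; first by rewrite big_ord1 expr0.
have S j : \sum_(i < j.+2) y ^+ i = 1 + y * \sum_(i < j.+1) y ^+ i.
  rewrite big_ord_recl/= expr0 mulr_sumr; congr (_ + _).
  by apply: eq_bigr => i _; rewrite exprS.
case/or3P: y3 => /eqP yE.
- by rewrite S yE mul0r addr0.
- rewrite yE in IH1 S *; rewrite S mul1r.
  by split=> [|_]; [rewrite addr_ge0|rewrite lerDl].
have E j : \sum_(i < j.+1) y ^+ i = (~~ odd j)%:R.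
  elim: j => [|j IHj]; first by rewrite big_ord1 expr0.
  by rewrite S IHj yE mulN1r/= negbK; case: (odd j); rewrite /= ?subr0 ?subrr.
by rewrite E; split=> // ->.
Qed.

(** [A n] is the product over [p ^ k] exactly dividing [n] of [\sum_(i < k.+1) X p ^+ i]. As [X p]
    is 0, 1 or -1, each factor is nonnegative, and at least 1 when [k] is even. *)
Lemma sum_divisors_real_char n : (0 < n)%N ->
  0 <= A n /\ ((forall p, ~~ odd (logn p n)) -> 1 <= A n).
Proof.
have [k] := ubnP n; elim: k n => // k IH n nk n0.
have [->|n1] := eqVneq n 1%N.
  by rewrite /A (_ : divisors 1 = [:: 1%N])// big_seq1 X1.
have pp : prime (pdiv n) by rewrite pdiv_prime// ltn_neqAle eq_sym n1.
have [n' cn nE] := pfactor_coprime pp n0.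
set p := pdiv n in pp cn nE; set v := logn p n in nE.
have n'0 : (0 < n')%N by move: n0; rewrite nE muln_gt0 => /andP[].
have v0 : (0 < v)%N by rewrite logn_gt0 mem_primes pp n0 pdiv_dvd.
have n'n : (n' < n)%N.
  by rewrite [X in (_ < X)%N]nE ltn_Pmulr// -(expn0 p) ltn_exp2l// prime_gt1.
have [h1 h2] := IH n' (leq_trans n'n nk) n'0.
have pn' : ~~ (p %| n')%N by rewrite -prime_coprime.
have -> : A n = (\sum_(i < v.+1) X p ^+ i) * A n' by rewrite {1}nE mulnC A_pX.
have [g1 g2] := geom_ge v (X3 p).
split=> [|hn]; first by rewrite mulr_ge0.
rewrite -[1]mulr1 ler_pM// ?g2 ?hn// h2// => q.
have [->|qp] := eqVneq q p.
  by rewrite lognE (negPf pn') andbF andbF.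
have := hn q; rewrite nE lognM ?expn_gt0 ?(prime_gt0 pp)// lognX (logn_prime q pp).
by rewrite (negPf qp) muln0 addn0.
Qed.

End RealCharacterSum.

(** Summation by parts: the differences [w k - w k.+1] are nonnegative and telescope, so the bound
    on the partial sums of [chi] is multiplied by [w a] in total. *)
Lemma abel_bound (C : numDomainType) (chi w : nat -> C) (B : C) (a : nat) :
  (forall b, `|\sum_(a <= k < b) chi k| <= B) ->
  (forall k, (a <= k)%N -> 0 <= w k) ->
  (forall k, (a <= k)%N -> w k.+1 <= w k) ->
  forall b, `|\sum_(a <= k < b) chi k * w k| <= B * w a.
Proof.
move=> hB w0 w1 b; have B0 : 0 <= B by exact: le_trans (hB a).
have [ba|ab] := leqP b a; first by rewrite big_geq// normr0 mulr_ge0// w0.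
set P := fun b => \sum_(a <= k < b) chi k.
have E c : (a <= c)%N -> \sum_(a <= k < c) chi k * w k =
    P c * w c + \sum_(a <= k < c) P k.+1 * (w k - w k.+1).
  elim: c => [|c IH]; first by rewrite /P !big_geq// mul0r addr0.
  rewrite leq_eqVlt => /orP[/eqP<-|]; first by rewrite /P !big_geq// mul0r addr0.
  rewrite ltnS => ac; rewrite !big_nat_recr//= IH//.
  by have -> : P c.+1 = P c + chi c; [rewrite /P big_nat_recr|ring].
rewrite E ?(ltnW ab)//; apply: le_trans (ler_normD _ _) _.
have -> : B * w a = B * w b + \sum_(a <= k < b) B * (w k - w k.+1).
  rewrite -mulr_sumr -mulrDr; congr (_ * _).
  under eq_bigr do rewrite -opprB.
  by rewrite sumrN telescope_sumr ?(ltnW ab)// opprB addrC subrK.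
rewrite lerD//.
  have wb := w0 _ (ltnW ab); rewrite normrM (ger0_norm wb).
  exact: ler_wpM2r wb _ _ (hB b).
apply: le_trans (ler_norm_sum _ _ _) _; apply: ler_sum_nat => k /andP[ak _].
have wk : 0 <= w k - w k.+1 by rewrite subr_ge0 w1.
rewrite normrM (ger0_norm wk); exact: ler_wpM2r wk _ _ (hB k.+1).
Qed.

Section MoebiusLog.
Variable R : realType.

Lemma vonmangoldt_pX pi p k : prime p ->
  vonmangoldt R pi (p ^ k.+1) = if p \in pi then ln p%:R else 0.
Proof.
move=> pp; have p1 := prime_gt1 pp; set d := (p ^ k.+1)%N.
have pd : (p <= d)%N by rewrite -{1}(expn1 p) leq_pexp2l// ltnW.
have kd : (k.+1 < d)%N by exact: ltn_expl.
rewrite /vonmangoldt big_mkcond (bigD1_seq p) ?iota_uniq ?mem_index_iota ?ltnS//=.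
rewrite pp [X in _ + X]big1 ?addr0; last first.
  move=> q qp; case: (boolP (prime q)) => //= pq; case: (q \in pi) => //.
  rewrite big1// => j /eqP dq; exfalso.
  have : (p %| q ^ j)%N by rewrite -dq dvdn_exp.
  by rewrite Euclid_dvdX// dvdn_prime2// eq_sym (negPf qp).
case: (p \in pi) => //=; rewrite big_mkcond (bigD1_seq k.+1) ?iota_uniq
  ?mem_index_iota ?ltnS ?(ltnW kd)//=.
rewrite eqxx big1 ?addr0// => j /negPf jk.
by rewrite /d eqn_exp2l// eq_sym jk.
Qed.

Lemma vonmangoldt_eq0 p d : prime p -> (p %| d)%N ->
  (forall k, d <> p ^ k)%N -> vonmangoldt R predT d = 0.
Proof.
move=> pp pd dp; rewrite /vonmangoldt big1// => q /andP[pq _].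
rewrite big1// => j /eqP dq; exfalso; apply: (dp j).
have : (p %| q ^ j)%N by rewrite -dq.
by rewrite Euclid_dvdX// dvdn_prime2// => /andP[/eqP -> _].
Qed.

(** With [n = p k], pairing [p d] with [d] leaves [- ln p] times the Moebius sum over the part [k']
    of [k] prime to [p]; that sum is nonzero only if [n] is a power of [p]. *)
Lemma sum_moebius_ln n : (0 < n)%N ->
  \sum_(d <- divisors n) (moebius d)%:~R * ln d%:R = - vonmangoldt R predT n.
Proof.
move=> n0; have [->|n1] := eqVneq n 1%N.
  rewrite (_ : divisors 1 = [:: 1%N])// big_seq1 ln1 mulr0.
  have := vonmangoldt_le_ln R (ltn0Sn 0); rewrite ln1 => h.
  by apply/eqP; rewrite eq_sym oppr_eq0 eq_le h vonmangoldt_ge0.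
have pp : prime (pdiv n) by rewrite pdiv_prime// ltn_neqAle eq_sym n1.
have pn := pdiv_dvd n; set p := pdiv n in pp pn.
have p0 := prime_gt0 pp.
have [k nk] := dvdnP pn; rewrite mulnC in nk.
have k0 : (0 < k)%N by move: n0; rewrite nk muln_gt0 => /andP[].
have [k' ck' kE] := pfactor_coprime pp k0; set v := logn p k in kE.
have k'0 : (0 < k')%N by move: k0; rewrite kE muln_gt0 => /andP[].
rewrite {1}nk sum_divisors_pM//.
rewrite [in X in _ + X]big_mkcond/= -big_split/=.
have pk' : ~~ (p %| k')%N by rewrite -prime_coprime.
transitivity (- (ln p%:R * (k' == 1)%N%:R) : R).
  have -> : (k' == 1)%N%:R = (\sum_(d <- divisors k') moebius d)%:~R :> R.
    by rewrite sum_moebius// rmorph_nat.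
  rewrite -(sum_divisors_coprime_pX v _ pp k'0 pk').
  rewrite mulnC -kE rmorph_sum/= mulr_sumr -sumrN [RHS]big_mkcond/= big_seq [RHS]big_seq.
  apply: eq_bigr => d; rewrite -dvdn_divisors// => /(dvdn_gt0 k0) d0.
  rewrite moebius_pM//; case: (p %| d)%N => /=; first by rewrite mul0r addr0.
  by rewrite natrM lnM ?posrE ?ltr0n// rmorphN/=; ring.
case: eqVneq => [k'1|k'1].
  by rewrite nk kE k'1 mul1n -expnS vonmangoldt_pX// mulr1.
rewrite mulr0 oppr0 (@vonmangoldt_eq0 p) ?oppr0// => j nj.
have : (k' %| p ^ j)%N by rewrite -nj nk kE mulnCA dvdn_mulr.
move=> /(dvdn_pfactor _ _ pp)[i _ k'E].
move: ck' k'1; rewrite k'E; case: i {k'E} => [|i]; first by rewrite expn0.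
by rewrite coprime_pexpr// /coprime gcdnn => /eqP p1; rewrite p1 in pp.
Qed.

End MoebiusLog.

(** * Nonvanishing for real characters *)

Section LambertKernel.
Variables (R : realFieldType) (x : R).
Hypothesis x01 : 0 < x < 1.

Let G n := \sum_(i < n) x ^+ i.

Let x0 : 0 < x. Proof. by case/andP: x01. Qed.
Let x1 : x < 1. Proof. by case/andP: x01. Qed.

Let GS n : G n.+1 = G n + x ^+ n.
Proof. by rewrite /G big_ord_recr. Qed.

Let GS' n : G n.+1 = 1 + x * G n.
Proof.
rewrite /G big_ord_recl expr0 mulr_sumr; congr (_ + _).
by apply: eq_bigr => i _; rewrite exprS.
Qed.

Lemma sum_expr_geom n : (1 - x) * \sum_(i < n) x ^+ i = 1 - x ^+ n.
Proof. by rewrite -/(G n); have := GS n; rewrite GS' => h; lra. Qed.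

Let Gxn n : n%:R * x ^+ n <= G n.
Proof.
rewrite mulr_natl -[n in _ *+ n]card_ord -sumr_const; apply: ler_sum => i _.
by apply: ler_wiXn2l; rewrite ?(ltW x0) ?(ltW x1)// ltnW.
Qed.

(** Pairing [x ^ i] with [x ^ (2 n - 1 - i)]: by the inequality of means their sum is at least
    [2 x ^ (n - 1/2)], hence at least [2 x ^ n]. *)
Let G2 n : 2 * n%:R * x ^+ n <= G n * (1 + x ^+ n).
Proof.
have -> : G n * (1 + x ^+ n) = \sum_(i < n) (x ^+ i + x ^+ (n + (n - i.+1))).
  rewrite big_split/= mulrDr mulr1 [G n * _]mulrC; congr (_ + _).
  rewrite /G (reindex_inj rev_ord_inj)/= mulr_sumr.
  by apply: eq_bigr => i _; rewrite exprD.
have -> : 2 * n%:R * x ^+ n = \sum_(i < n) 2 * x ^+ n.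
  by rewrite sumr_const card_ord -[RHS]mulr_natr; ring.
apply: ler_sum => -[i ni] _ /=.
have [a ->] : exists a, n = (i + a.+1)%N by exists (n - i.+1)%N; lia.
have -> : (i + a.+1 + (i + a.+1 - i.+1) = i + (a + a.+1))%N by lia.
rewrite !exprD !exprS.
have xi : 0 < x ^+ i by rewrite exprn_gt0.
have xa : 0 <= x ^+ a by rewrite exprn_ge0// ltW.
move: (x ^+ i) (x ^+ a) xi xa => u v u0 v0.
have -> : 2 * (u * (x * v)) = u * (2 * (x * v)) by ring.
rewrite -[X in X + _]mulr1 -mulrDr ler_pM2l//.
have : 0 <= (1 - x * v) ^+ 2 + x * v * v * (1 - x).
  by rewrite addr_ge0 ?sqr_ge0// !mulr_ge0 ?(ltW x0)// subr_ge0 ltW.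
by move=> h; lra.
Qed.

(** This is the monotonicity of [lambert_gap] with denominators cleared; the induction step amounts
    to [G2]. *)
Let GG n : n%:R * n.+1%:R * x ^+ n <= G n * G n.+1.
Proof.
elim: n => [|n IH]; first by rewrite !mul0r /G big_ord0 mul0r.
have -> : G n.+1 * G n.+2 = x * (G n * G n.+1) + G n.+1 * (1 + x ^+ n.+1).
  by rewrite (GS' n.+1) exprS GS; ring.
have := G2 n.+1; have := ler_wpM2l (ltW x0) IH.
rewrite -!natr1 exprS => h1 h2; lra.
Qed.

Let G_gt0 n : (0 < n)%N -> 0 < G n.
Proof.
case: n => // n _; rewrite GS' ltr_wpDr// mulr_ge0 ?(ltW x0)// sumr_ge0// => i _.
by rewrite exprn_ge0 ?(ltW x0).
Qed.

(* Subtracting [1 / (n (1 - x))] makes the Lambert kernel monotone in [n], so that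
   Abel summation applies uniformly in [x]. *)
Definition lambert_gap n : R := (n%:R * (1 - x))^-1 - x ^+ n / (1 - x ^+ n).

Let gapE n : (0 < n)%N -> lambert_gap n = (n%:R^-1 - x ^+ n / G n) / (1 - x).
Proof.
move=> n0; rewrite /lambert_gap -sum_expr_geom -/(G n).
have h1 : G n != 0 by rewrite gt_eqF ?G_gt0.
have h2 : 1 - x != 0 by rewrite subr_eq0 gt_eqF.
have h3 : n%:R != 0 :> R by rewrite pnatr_eq0 -lt0n.
by field; rewrite h1 h2 h3.
Qed.

Lemma lambert_gap_ge0 n : (0 < n)%N -> 0 <= lambert_gap n.
Proof.
move=> n0; rewrite gapE// divr_ge0 ?subr_ge0 ?(ltW x1)//.
by rewrite ler_pdivrMr ?G_gt0// mulrC ler_pdivlMr ?ltr0n// mulrC Gxn.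
Qed.

Lemma lambert_gap_dec n : (0 < n)%N -> lambert_gap n.+1 <= lambert_gap n.
Proof.
move=> n0; rewrite !gapE// ler_pM2r ?invr_gt0 ?subr_gt0//.
rewrite -subr_ge0.
have h0 := G_gt0 n0; have h1 := @G_gt0 n.+1 isT.
have n0' : 0 < n%:R :> R by rewrite ltr0n.
have n1 : 0 < n%:R + 1 :> R by rewrite ltr_pwDr.
have -> : n%:R^-1 - x ^+ n / G n - (n.+1%:R^-1 - x ^+ n.+1 / G n.+1) =
    (G n * G n.+1 - n%:R * n.+1%:R * x ^+ n) / (n%:R * n.+1%:R * (G n * G n.+1)).
  have e : x ^+ n.+1 = x ^+ n * (G n.+1 - 1) / G n.
    by rewrite (GS' n) [1 + _]addrC addrK mulrA mulfK ?gt_eqF// exprSr.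
  rewrite e -natr1; field.
  by rewrite !gt_eqF.
rewrite divr_ge0 ?subr_ge0 ?GG// mulr_ge0// mulr_ge0// ltW//.
Qed.

Lemma lambert_gap1 : lambert_gap 1 = 1.
Proof.
by rewrite /lambert_gap mul1r expr1; field; rewrite subr_eq0 gt_eqF.
Qed.

End LambertKernel.

Lemma bernoulli_ge (R : realDomainType) (t : R) n : 0 <= t <= 1 ->
  1 - n%:R * t <= (1 - t) ^+ n.
Proof.
move=> /andP[t0 t1]; elim: n => [|n IH]; first by rewrite mul0r subr0 expr0.
have t1' : 0 <= 1 - t by rewrite subr_ge0.
rewrite exprS; apply: le_trans (ler_wpM2l t1' IH).
have : 0 <= n%:R * t * t by rewrite !mulr_ge0.
by rewrite -natr1; move: (n%:R) => u h; lra.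
Qed.

Lemma expr3_expR_le (R : realType) (y : R) : 0 <= y -> y ^+ 3 * expR (- y) <= 6.
Proof.
move=> y0; rewrite expRN ler_pdivrMr ?expR_gt0//.
have := expR_ge1Dxn 2 y0; rewrite (_ : 3`!%:R = 6 :> R)// => h.
by move: (y ^+ 3) h => u h; lra.
Qed.

(** * Growth of the truncated Lambert series of a real character *)

Section RealNonvanishing.
Variables (R : realType) (X : nat -> R) (B c : R).
Hypothesis X1 : X 1%N = 1.
Hypothesis XM : forall a b, X (a * b)%N = X a * X b.
Hypothesis X3 : forall a, [|| X a == 0, X a == 1 | X a == -1].
Hypothesis XB : forall b, `|\sum_(1 <= k < b) X k| <= B.
Hypothesis Xc : forall N, (0 < N)%N -> `|\sum_(1 <= k < N.+1) X k / k%:R| <= c / N%:R.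

Let A n := \sum_(d <- divisors n) X d.

Let E x N := \sum_(1 <= j < N.+1) A j * x ^+ j.

Let X_norm a : `|X a| <= 1.
Proof. by case/or3P: (X3 a) => /eqP ->; rewrite ?normr0 ?normrN1 ?normr1. Qed.

Let A_ge0 n : (0 < n)%N -> 0 <= A n.
Proof. by move=> /(sum_divisors_real_char X1 XM X3)[]. Qed.

Let A_sqr k : (0 < k)%N -> 1 <= A (k ^ 2).
Proof.
move=> k0; have k20 : (0 < k ^ 2)%N by rewrite expn_gt0 k0.
have [_ h] := sum_divisors_real_char X1 XM X3 k20; apply: h => p.
by rewrite lognX oddM.
Qed.

Let E_exchange x N :
  E x N = \sum_(1 <= n < N.+1) X n * \sum_(1 <= k < (N %/ n).+1) x ^+ (n * k).
Proof.
under [RHS]eq_bigr do rewrite mulr_sumr.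
rewrite -(sum_dvd_exchange N (fun n k => X n * x ^+ (n * k))) /E.
apply: eq_big_nat => j /andP[j0 jN].
rewrite /A -(big_divisors X j0 (jN : (j <= N)%N)) mulr_suml; apply: eq_bigr => d dj.
by rewrite mulnC divnK.
Qed.

Let sum_pow (x : R) n q : x ^+ n != 1 ->
  \sum_(1 <= k < q.+1) x ^+ (n * k) =
  x ^+ n / (1 - x ^+ n) - x ^+ (n * q.+1) / (1 - x ^+ n).
Proof.
move=> xn; have h : 1 - x ^+ n != 0 by rewrite subr_eq0 eq_sym.
elim: q => [|q IH]; first by rewrite big_geq// muln1 subrr.
rewrite big_nat_recr//= IH [in RHS]mulnS exprD; field.
exact: h.
Qed.

(** The kernel [x ^ n / (1 - x ^ n)] is [1 / (n (1 - x))] minus [lambert_gap x n]. The first part is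
    controlled by [Xc], the second by Abel summation, the gap being 1 at [n = 1]; the last term
    bounds the tails of the geometric series cut at [N %/ n]. *)
Let E_upper (x : R) N : 0 < x < 1 -> (0 < N)%N ->
  E x N <= c / N%:R / (1 - x) + B + N%:R * (x ^+ N / (1 - x)).
Proof.
move=> x01 N0; have /andP[x0 x1] := x01.
have x1' : 0 < 1 - x by rewrite subr_gt0.
have xn n : (0 < n)%N -> x ^+ n <= x.
  by move=> n0; rewrite -[leRHS]expr1 ler_wiXn2l// ltW.
have -> : E x N = (\sum_(1 <= n < N.+1) X n / n%:R) / (1 - x)
   - \sum_(1 <= n < N.+1) X n * lambert_gap x n
   - \sum_(1 <= n < N.+1) X n * (x ^+ (n * (N %/ n).+1) / (1 - x ^+ n)).
  rewrite E_exchange mulr_suml -!sumrB; apply: eq_big_nat => n /andP[n0 _].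
  rewrite sum_pow; last by rewrite lt_eqF// (le_lt_trans (xn _ n0)).
  by rewrite /lambert_gap invfM mulrA; ring.
apply: lerD; first apply: lerD.
- by rewrite ler_pM2r ?invr_gt0// (le_trans (ler_norm _))// Xc.
- apply: le_trans (ler_norm _) _; rewrite normrN -[B]mulr1 -(lambert_gap1 x01).
  apply: abel_bound => //.
    by move=> k; exact: lambert_gap_ge0.
  by move=> k; exact: lambert_gap_dec.
- apply: le_trans (ler_norm _) _; rewrite normrN.
  apply: le_trans (ler_norm_sum _ _ _) _.
  apply: (@le_trans _ _ (\sum_(1 <= n < N.+1) x ^+ N / (1 - x))); last first.
    by rewrite sumr_const_nat subSS subn0 mulr_natl.
  apply: ler_sum_nat => n /andP[n0 _].
  have xn1 : 0 < 1 - x ^+ n by rewrite subr_gt0 (le_lt_trans (xn _ n0)).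
  have q0 : 0 <= x ^+ (n * (N %/ n).+1) / (1 - x ^+ n).
    by rewrite divr_ge0// ?exprn_ge0// ltW.
  rewrite normrM (ger0_norm q0); apply: le_trans (ler_wpM2r q0 (X_norm n)) _.
  rewrite mul1r ler_pM ?exprn_ge0 ?invr_ge0 ?(ltW x0) ?(ltW xn1)//.
    by apply: ler_wiXn2l; rewrite ?(ltW x0) ?(ltW x1)// mulnC ltnW// ltn_ceil.
  by rewrite lef_pV2 ?posrE// lerD2l lerN2 xn.
Qed.

(** All coefficients are nonnegative and those at squares are at least 1, so the squares alone
    suffice. *)
Let E_lower (x : R) K N : 0 < x -> (K ^ 2 <= N)%N ->
  \sum_(1 <= k < K.+1) x ^+ (k ^ 2) <= E x N.
Proof.
move=> x0 KN.
have t0 j : (0 < j)%N -> 0 <= A j * x ^+ j.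
  by move=> j0; rewrite mulr_ge0 ?A_ge0// exprn_ge0// ltW.
have mono a b : (a <= b)%N -> E x a <= E x b.
  move=> ab; rewrite /E [leRHS](big_cat_nat (n := a.+1))//= lerDl big_nat sumr_ge0// => j.
  by move=> /andP[aj _]; rewrite t0// (leq_ltn_trans _ aj).
apply: le_trans (mono _ _ KN); elim: K {KN} => [|K IH].
  by rewrite big_geq// /E big_geq.
rewrite big_nat_recr//=.
have [J e] : exists J, (K.+1 ^ 2 = J.+1)%N.
  by exists (K.+1 ^ 2).-1; rewrite prednK// expn_gt0.
have -> : E x (K.+1 ^ 2) = E x J + A (K.+1 ^ 2) * x ^+ (K.+1 ^ 2).
  by rewrite e /E big_nat_recr.
rewrite lerD//; last by rewrite ler_peMl ?exprn_ge0 ?(ltW x0)// A_sqr.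
apply: le_trans IH (mono _ _ _); rewrite -ltnS -e.
by rewrite ltn_exp2r.
Qed.

Lemma real_char_sum_not_small : False.
Proof.
have c0 : 0 <= c.
  by have := Xc (ltn0Sn 0); rewrite divr1; apply: le_trans.
(* [E x N] at [x = 1 - 1 / (2 K ^ 2)] and [N = (2 K ^ 2) ^ 2]. *)
have key K : (0 < K)%N -> K%:R / 2 <= c + B + 6.
  move=> K0; pose M := (2 * K ^ 2)%N.
  have M2 : (2 <= M)%N by rewrite /M leq_pmulr// expn_gt0 K0.
  have M0 : (0 < M)%N by exact: leq_trans M2.
  have Mr : 0 < M%:R :> R by rewrite ltr0n.
  have MV : M%:R^-1 <= 1 / 2 :> R by rewrite div1r lef_pV2 ?posrE// ler_nat.
  have MV0 : 0 < M%:R^-1 :> R by rewrite invr_gt0.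
  pose x : R := 1 - M%:R^-1.
  have x01 : 0 < x < 1 by rewrite /x; apply/andP; split; lra.
  have /andP[x0 x1] := x01.
  have KN : (K ^ 2 <= M ^ 2)%N.
    rewrite leq_exp2r// /M; apply: leq_trans (leq_pmull _ (ltn0Sn 1)).
    by rewrite -{1}(expn1 K) leq_pexp2l.
  have N0 : (0 < M ^ 2)%N by rewrite expn_gt0 M0.
  have h1 := E_lower x0 KN; have h2 := E_upper x01 N0.
  (* By Bernoulli's inequality [x ^ (k ^ 2) >= 1 - k ^ 2 / M >= 1 / 2] for [k <= K], as
     [M = 2 K ^ 2]. *)
  apply: (@le_trans _ _ (\sum_(1 <= k < K.+1) x ^+ (k ^ 2))).
    have -> : K%:R / 2 = \sum_(1 <= k < K.+1) (1 / 2) :> R.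
      by rewrite sumr_const_nat subSS subn0 -[RHS]mulr_natl div1r.
    apply: ler_sum_nat => k /andP[k0 kK].
    have MV1 : 0 <= (M%:R^-1 : R) <= 1 by apply/andP; split; lra.
    apply: le_trans (bernoulli_ge (k ^ 2) MV1).
    suff : (k ^ 2)%:R / M%:R <= 1 / 2 :> R by lra.
    rewrite ler_pdivrMr// mul1r mulrC ler_pdivlMr// -natrM ler_nat.
    by rewrite /M mulnC leq_mul2l leq_exp2r.
  apply: le_trans h1 (le_trans h2 _).
  have xE : 1 - x = M%:R^-1 by rewrite /x opprB addrC subrK.
  (* With [N = M ^ 2] and [1 - x = 1 / M] the first term is [c / M], and the last is at most
     [M ^ 3 exp(- M)] because [x <= exp(- 1 / M)]. *)
  have a1 : c / (M ^ 2)%:R / (1 - x) <= c.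
    rewrite xE invrK natrX expr2 invfM mulrA divfK ?gt_eqF//.
    by rewrite ler_piMr// invf_le1// ler1n.
  have a2 : (M ^ 2)%:R * (x ^+ (M ^ 2) / (1 - x)) <= 6.
    rewrite xE invrK; apply: le_trans (expr3_expR_le (ltW Mr)).
    have -> : M%:R ^+ 3 * expR (- M%:R) = (M ^ 2)%:R * (expR (- M%:R) * M%:R) :> R.
      by rewrite natrX; ring.
    rewrite ler_wpM2l// ler_wpM2r ?(ltW Mr)//.
    have -> : - M%:R = - M%:R^-1 * (M ^ 2)%:R :> R.
      by rewrite natrX; field; rewrite gt_eqF.
    rewrite expRM_natr; rewrite lerXn2r ?nnegrE ?(ltW x0) ?expR_ge0//.
    exact: expR_ge1Dx.
  by move: a1 a2; move: (c / _ / _) (_ * (_ / _)) => u v; lra.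
pose y := 2 * (c + B + 6).
have := key (Num.truncn y).+1 isT; have := truncnS_gt y; rewrite /y; lra.
Qed.

End RealNonvanishing.

(** * Dirichlet characters and Mertens' theorem *)

Section CharacterBasis.
Variables (C : numClosedFieldType).

Definition dchar (m : nat) (chi : nat -> C) : Prop :=
  [/\ forall a b, chi (a * b)%N = chi a * chi b,
      forall a, chi (a + m)%N = chi a,
      forall a, coprime a m -> `|chi a| = 1 &
      forall a, ~~ coprime a m -> chi a = 0].

Lemma dchar1 m chi : dchar m chi -> chi 1%N = 1.
Proof.
case=> chiM _ chin _; have c1 : chi 1%N != 0.
  by rewrite -normr_eq0 chin ?coprime1n// oner_eq0.
by apply: (mulIf c1); rewrite mul1r -chiM.
Qed.

Lemma periodic_modn (T : Type) (m : nat) (f : nat -> T) :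
  (forall a, f (a + m)%N = f a) -> forall a, f (a %% m)%N = f a.
Proof.
move=> fm a; rewrite [in RHS](divn_eq a m).
elim: (a %/ m)%N => [|k IH]; first by rewrite mul0n.
by rewrite mulSn -addnA addnC fm.
Qed.

Variable m' : nat.
Let m := m'.+1.

Let mulmat (a : nat) : 'M[C]_m :=
  \matrix_(i, j) ((i : nat) == (j * a) %% m)%N%:R.

Let mul_mulmat (r : 'rV[C]_m) a j :
  (r *m mulmat a) 0 j = r 0 (inord ((j * a) %% m)).
Proof.
rewrite mxE (bigD1 (inord ((j * a) %% m)))//= big1 ?addr0; last first.
  move=> i; rewrite mxE -val_eqE/= inordK ?ltn_mod// => /negPf ->.
  by rewrite mulr0.
by rewrite mxE inordK ?ltn_mod// eqxx mulr1.
Qed.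

Let mulmatM a b : mulmat a *m mulmat b = mulmat (b * a)%N.
Proof.
apply/row_matrixP => i; rewrite row_mul; apply/rowP => j.
rewrite mul_mulmat !mxE inordK ?ltn_mod// modnMml mulnA.
by congr (_ == _)%:R.
Qed.

Let mulmat1 a : a = 1 %[mod m] -> mulmat a = 1%:M.
Proof.
move=> a1; apply/matrixP => i j; rewrite !mxE -modnMmr a1 modnMmr muln1 modn_small//.
Qed.

Let mulmatX a k : mulmat a ^+ k = mulmat (a ^ k).
Proof.
elim: k => [|k IH]; first by rewrite expr0 mulmat1.
by rewrite exprSr IH -[LHS]/(_ *m _) mulmatM expnS.
Qed.

(** By Euler's theorem the matrix is a root of ['X^k - 1] with [k = totient m], which splits with
    simple roots. *)
Let mulmat_diag a : coprime a m -> diagonalizable (mulmat a).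
Proof.
move=> am; apply/diagonalizableP.
pose k := totient m; have k0 : (0 < k)%N by rewrite totient_gt0.
have [rs rsE] := closed_field_poly_normal ('X^k - 1 : {poly C}).
have lc : lead_coef ('X^k - 1 : {poly C}) = 1 by rewrite -[1]/(1%:P) lead_coefXnsubC.
rewrite lc scale1r in rsE.
exists rs.
  rewrite -separable.separable_prod_XsubC -rsE.
  by apply: cyclotomic.separable_Xn_sub_1; rewrite pnatr_eq0 -lt0n.
rewrite -rsE; apply: mxminpoly_min.
rewrite rmorphB rmorphXn/= horner_mx_X rmorph1 mulmatX.
by rewrite mulmat1 ?subrr// cyclic.Euler_exp_totient.
Qed.

(* Multiplications by units commute and have finite order, so they can be
   diagonalised simultaneously; the rows of a diagonalising matrix are multiples of characters. *)
Lemma dchar_span (f : nat -> C) :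
  (forall a, f (a + m)%N = f a) -> (forall a, ~~ coprime a m -> f a = 0) ->
  exists (c : 'I_m -> C) (chi : 'I_m -> nat -> C),
    (forall i, dchar m (chi i)) /\ forall a, f a = \sum_i c i * chi i a.
Proof.
move=> fm f0.
pose As := [seq mulmat a | a <- iota 0 m & coprime a m].
have memAs a : coprime a m -> mulmat (a %% m) \in As.
  by move=> am; apply: map_f; rewrite mem_filter coprime_modl am mem_iota/= ltn_mod.
have /codiagonalizableP[P Pu /allP PD] : {in As &, forall f g, comm_mx f g} /\
    (forall f, f \in As -> diagonalizable f).
  split=> [A B /mapP[a _ ->] /mapP[b _ ->]|A /mapP[a + ->]].
    by rewrite /comm_mx !mulmatM mulnC.
  by rewrite mem_filter => /andP[am _]; exact: mulmat_diag.
have Peig a : coprime a m -> exists D : 'rV_m, forall i (j : 'I_m),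
    P i (inord ((j * a) %% m)) = D 0 i * P i j.
  move=> am; have /PD/similar_diagPex[D /(similarP Pu) PA] := memAs _ am.
  exists D => i j; have := congr1 (fun M => (row i M) 0 j) PA.
  by rewrite /= row_mul mul_mulmat modnMmr mul_diag_mx !mxE.
pose p0 : 'I_m := inord (1 %% m).
(* A row of [P] is an eigenvector of each [mulmat a]; evaluating at 1 identifies the eigenvalue,
   which gives multiplicativity up to the value at 1. *)
have P1 i a : coprime a m -> forall b, 
  P i (inord ((b * a) %% m)) * P i p0 = P i (inord (a %% m)) * P i (inord (b %% m)).
  move=> /Peig[D PDa] b.
  have := PDa i (inord (b %% m)); rewrite inordK ?ltn_mod// modnMml => ->.
  have := PDa i p0; rewrite inordK ?ltn_mod// modnMml mul1n => ->.
  by rewrite -!mulrA; congr (_ * _); rewrite mulrC.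
(* A row whose entry at 1 is 0 vanishes on all units; the principal character stands in for it, with
   coefficient 0. *)
pose chi i a := if coprime a m then
  (if P i p0 == 0 then 1 else P i (inord (a %% m)) / P i p0) else 0.
pose F : 'rV[C]_m := \row_j f j.
exists (fun i => (F *m invmx P) 0 i * P i p0), chi; split.
- move=> i.
  have chiM a b : chi i (a * b)%N = chi i a * chi i b.
    rewrite /chi coprimeMl; case: (boolP (coprime a m)) => [am|_]; last by rewrite mul0r.
    case: (boolP (coprime b m)) => [bm|_]; last by rewrite mulr0.
    rewrite /=; case: eqP => [_|/eqP p0N0]; first by rewrite mulr1.
    apply: (mulIf p0N0); rewrite divfK//.
    apply: (mulIf p0N0); rewrite P1//; field; exact: p0N0.
  have chim a : chi i (a + m)%N = chi i a.
    by rewrite /chi modnDr -[coprime (a + m) m]coprime_modl modnDr coprime_modl.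
  split=> // a am; last by rewrite /chi (negPf am).
  have chiX k : chi i (a ^ k)%N = chi i a ^+ k.
    elim: k => [|k IH]; last by rewrite expnS chiM IH exprS.
    by rewrite expn0 expr0 /chi coprime1n; case: eqP => // /eqP ?; rewrite divff.
  have := chiX (totient m); rewrite -(periodic_modn chim) cyclic.Euler_exp_totient//.
  rewrite periodic_modn// -(expn0 a) chiX expr0 => /(congr1 (fun z : C => `|z|)).
  by rewrite normrX normr1 => /esym/eqP; rewrite pexpr_eq1 ?totient_gt0// => /eqP->.
move=> a; case: (boolP (coprime a m)) => [am|am]; last first.
  by rewrite f0// big1// => i _; rewrite /chi (negPf am) mulr0.
rewrite -(periodic_modn fm).
have -> : f (a %% m)%N = F 0 (inord (a %% m)) by rewrite mxE inordK ?ltn_mod.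
rewrite -[F in LHS](mulmxKV Pu) mxE; apply: eq_bigr => i _.
rewrite /chi am -mulrA; congr (_ * _); case: eqP => [p00|/eqP p00]; last first.
  by rewrite mulrC divfK.
have [D PDa] := Peig _ am.
have := PDa i p0; rewrite inordK ?ltn_mod// modnMml mul1n => ->.
by rewrite p00 mulr0 mul0r.
Qed.

End CharacterBasis.

Section ComplexSums.
Local Open Scope complex_scope.

Section ComplexAbs.
Variable R : realType.
Implicit Types z w : R[i].

(* The norm [`|z|] of the library is an element of [R[i]]. *)
Definition cabs z : R := complex.Re `|z|.

Lemma cabs_normC z : (cabs z)%:C = `|z|.
Proof. by rewrite /cabs RRe_real// normr_real. Qed.

Lemma cabs_le z (K : R) : (cabs z <= K) = (`|z| <= K%:C).
Proof. by rewrite -lecR cabs_normC. Qed.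

Lemma cabs_ge0 z : 0 <= cabs z.
Proof. by rewrite -lecR cabs_normC; exact: normr_ge0. Qed.

Lemma cabs0 : cabs 0 = 0.
Proof. by rewrite /cabs normr0. Qed.

Lemma cabsM z w : cabs (z * w) = cabs z * cabs w.
Proof. by apply: complexI; rewrite rmorphM !cabs_normC normrM. Qed.

Lemma cabsN z : cabs (- z) = cabs z.
Proof. by rewrite /cabs normrN. Qed.

Lemma cabsD z w : cabs (z + w) <= cabs z + cabs w.
Proof. by rewrite -lecR rmorphD !cabs_normC ler_normD. Qed.

Lemma cabs_sum (I : Type) (s : seq I) (P : pred I) (F : I -> R[i]) :
  cabs (\sum_(i <- s | P i) F i) <= \sum_(i <- s | P i) cabs (F i).
Proof.
elim/big_ind2: _ => [|x u y v xu yv|//]; first by rewrite cabs0.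
by apply: le_trans (cabsD _ _) _; rewrite lerD.
Qed.

Lemma cabs_real (x : R) : cabs x%:C = `|x|.
Proof. by apply: complexI; rewrite cabs_normC normc_def/= expr0n addr0 sqrtr_sqr. Qed.

Lemma cabs_real_ge0 (x : R) : 0 <= x -> cabs x%:C = x.
Proof. by move=> x0; rewrite cabs_real ger0_norm. Qed.

Lemma normRe_le z : `|complex.Re z| <= cabs z.
Proof.
rewrite -sqrtr_sqr /cabs normc_def/= ler_wsqrtr// lerDl sqr_ge0//.
Qed.

End ComplexAbs.

(** * Partial sums at 1 of the series attached to a nonprincipal character *)

Section CharacterSums.
Variables (R : realType) (m : nat) (chi : nat -> R[i]).
Hypothesis m0 : (0 < m)%N.
Hypothesis chiP : dchar m chi.
Hypothesis chi_nonprincipal : exists2 a, coprime a m & chi a != 1.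

Local Notation Lam := (vonmangoldt R predT).
Local Notation B := ((2 * m)%:R : R).

Let chiM a b : chi (a * b)%N = chi a * chi b. Proof. by case: chiP. Qed.
Let chim a : chi (a + m)%N = chi a. Proof. by case: chiP. Qed.

Lemma dchar_cabs_le a : cabs (chi a) <= 1.
Proof.
case: chiP => _ _ h1 h0; rewrite cabs_le; case: (boolP (coprime a m)) => am.
  by rewrite h1.
by rewrite h0// normr0 ler01.
Qed.

(** Multiplication by a unit [a] permutes the residues and multiplies the sum by [chi a], which can
    be chosen different from 1. *)
Lemma dchar_sum_period : \sum_(k < m) chi k = 0.
Proof.
have [a am a1] := chi_nonprincipal; pose f (k : 'I_m) := Ordinal (ltn_pmod (a * k) m0).
have finj : injective f.
  have le_inj (i j : 'I_m) : (i <= j)%N -> f i = f j -> i = j.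
    move=> ij /(congr1 val)/= /esym/eqP.
    rewrite eqn_mod_dvd ?leq_mul// -mulnBr Gauss_dvdr 1?coprime_sym// => mij.
    apply/val_inj/eqP; rewrite eqn_leq ij/= -subn_eq0.
    apply: contraTT mij; rewrite -lt0n => ij0.
    by rewrite gtnNdvd// (leq_ltn_trans (leq_subr _ _)).
  by move=> i j fij; case/orP: (leq_total i j) => ij; [|symmetry]; apply: le_inj.
apply/eqP; move: a1; apply: contraNT => S0.
apply/eqP/(mulIf S0); rewrite mul1r mulr_sumr [RHS](reindex_inj finj)/=.
by apply: eq_bigr => k _; rewrite (periodic_modn chim) chiM.
Qed.

Let sum_lt b : cabs (\sum_(0 <= k < b) chi k) <= m%:R.
Proof.
rewrite (divn_eq b m) (big_cat_nat (n := (b %/ m * m)%N)) ?leq_addr//=.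
have -> : \sum_(0 <= k < b %/ m * m) chi k = 0.
  elim: (b %/ m)%N => [|q IH]; first by rewrite big_geq.
  rewrite mulSn addnC (big_cat_nat (n := (q * m)%N)) ?leq_addr//= IH add0r.
  rewrite -{1}[(q * m)%N]add0n big_addn addKn big_mkord -[RHS]dchar_sum_period.
  apply: eq_bigr => k _; rewrite -(periodic_modn chim) addnC modnMDl.
  by rewrite (periodic_modn chim).
rewrite add0r -{1}[(b %/ m * m)%N]add0n big_addn addKn.
apply: le_trans (cabs_sum _ _ _) _.
apply: (@le_trans _ _ (\sum_(0 <= k < b %% m) 1)).
  by apply: ler_sum => k _; exact: dchar_cabs_le.
by rewrite sumr_const_nat subn0 ler_nat ltnW// ltn_pmod.
Qed.

Lemma dchar_sum_le a b : `|\sum_(a <= k < b) chi k| <= B%:C.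
Proof.
rewrite -cabs_le; have [ab|ba] := leqP a b; last by rewrite big_geq ?cabs0// ltnW.
have -> : \sum_(a <= k < b) chi k =
    \sum_(0 <= k < b) chi k - \sum_(0 <= k < a) chi k.
  by rewrite [in RHS](big_cat_nat (n := a))//= addrAC subrr add0r.
apply: le_trans (cabsD _ _) _; rewrite cabsN mul2n -addnn natrD.
by rewrite lerD ?sum_lt.
Qed.

Lemma dchar_abel (w : nat -> R) a b :
  (forall k, (a <= k)%N -> 0 <= w k) ->
  (forall k, (a <= k)%N -> w k.+1 <= w k) ->
  cabs (\sum_(a <= k < b) chi k * (w k)%:C) <= B * w a.
Proof.
move=> w0 w1; rewrite cabs_le rmorphM.
apply: (@abel_bound _ chi (fun k => (w k)%:C)) => [c|k ak|k ak].
- exact: dchar_sum_le.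
- by rewrite lecR w0.
- by rewrite lecR w1.
Qed.

(** Partial sums of [L(1, chi)]. *)
Definition harmonic_sum n : R[i] := \sum_(1 <= k < n.+1) chi k * (k%:R^-1)%:C.

(** Partial sums of the series for [- L' / L] at 1. *)
Definition mangoldt_sum n : R[i] := \sum_(1 <= d < n.+1) chi d * (Lam d / d%:R)%:C.

Lemma harmonic_sum_dist a b : (a <= b)%N ->
  cabs (harmonic_sum b - harmonic_sum a) <= B / a.+1%:R.
Proof.
move=> ab; rewrite /harmonic_sum (big_cat_nat (n := a.+1) (p := b.+1))//=.
rewrite addrAC subrr add0r; apply: dchar_abel => k ak.
  by rewrite invr_ge0.
rewrite lef_pV2 ?posrE ?ltr0n ?ler_nat//.
exact: leq_trans ak.
Qed.

Let log_sum_bound : exists C1, forall n,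
  cabs (\sum_(1 <= k < n.+1) chi k * (ln k%:R / k%:R)%:C) <= C1.
Proof.
exists (B * (ln 4%:R / 4%:R) + \sum_(1 <= k < 4) (ln k%:R / k%:R)) => n.
have t0 k : 0 <= ln k%:R / k%:R :> R by rewrite divr_ge0// ln_nat_ge0.
have b4 k : (k <= 4)%N -> cabs (\sum_(1 <= k < k) chi k * (ln k%:R / k%:R)%:C) <=
    \sum_(1 <= k < 4) (ln k%:R / k%:R).
  case: k => [|k] k4; first by rewrite big_geq// cabs0 sumr_ge0.
  rewrite [leRHS](big_cat_nat (n := k.+1))//= ler_wpDr ?sumr_ge0//.
  apply: le_trans (cabs_sum _ _ _) _; apply: ler_sum => j _.
  by rewrite cabsM (cabs_real_ge0 (t0 j)) ler_piMl// dchar_cabs_le.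
(* [ln k / k] decreases as soon as [1 <= ln k]. *)
have [n4|n4] := leqP n.+1 4.
  by apply: ler_wpDl; [rewrite mulr_ge0|exact: b4].
rewrite (big_cat_nat (n := 4))//=; last exact: ltnW.
apply: le_trans (cabsD _ _) _; rewrite addrC lerD//; last exact: b4.
apply: (@dchar_abel (fun k => ln k%:R / k%:R)) => // k k4.
have k0 : 0 < k%:R :> R by rewrite ltr0n (leq_trans _ k4).
have lnk : 1 <= ln k%:R :> R.
  have h2 : 1 / 2 <= ln 2 :> R.
    have := @le_ln1Dx R (- (1 / 2)); rewrite (_ : 1 - 1 / 2 = 2^-1); last by field.
    by rewrite lnV ?posrE// => h; have := h ltac:(lra); lra.
  apply: (@le_trans _ _ (ln 4%:R)); last by rewrite ler_ln ?posrE ?ler_nat.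
  by rewrite (_ : 4%:R = 2 * 2) ?lnM ?posrE//; [lra|rewrite -natrM].
have lnS : ln k.+1%:R <= ln k%:R + k%:R^-1 :> R.
  have -> : k.+1%:R = k%:R * (1 + k%:R^-1) :> R by rewrite mulrDr divff ?gt_eqF// mulr1 natr1.
  have kV : 0 < k%:R^-1 :> R by rewrite invr_gt0.
  by rewrite lnM ?posrE ?lerD// ?le_ln1Dx// ?addr_gt0//; apply: lt_trans kV; lra.
rewrite ler_pdivrMr ?ltr0n// mulrAC ler_pdivlMr//.
have : ln k.+1%:R * k%:R <= (ln k%:R + k%:R^-1) * k%:R :> R by rewrite ler_wpM2r// ltW.
rewrite mulrDl mulVf ?gt_eqF// -natr1; lra.
Qed.

Let coefM a b : chi (a * b)%N * ((a * b)%:R^-1)%:C =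
  (chi a * (a%:R^-1)%:C) * (chi b * (b%:R^-1)%:C).
Proof. by rewrite chiM natrM invfM rmorphM/=; ring. Qed.

Let log_sumE n : \sum_(1 <= k < n.+1) chi k * (ln k%:R / k%:R)%:C =
  \sum_(1 <= d < n.+1) chi d * (Lam d / d%:R)%:C * harmonic_sum (n %/ d).
Proof.
under [RHS]eq_bigr do rewrite /harmonic_sum mulr_sumr.
rewrite -(sum_dvd_exchange n (fun d k =>
  chi d * (Lam d / d%:R)%:C * (chi k * (k%:R^-1)%:C))).
apply: eq_big_nat => k /andP[k0 kn].
have -> : ln k%:R = \sum_(1 <= d < n.+1 | (d %| k)%N) Lam d.
  by rewrite sum_vonmangoldt// partnT.
rewrite mulr_suml rmorph_sum/= mulr_sumr; apply: eq_bigr => d dk.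
have := coefM d (k %/ d); rewrite mulnC divnK// => e.
rewrite !rmorphM/=.
have -> : chi k * ((Lam d)%:C * (k%:R^-1)%:C) = (Lam d)%:C * (chi k * (k%:R^-1)%:C) by ring.
by rewrite e; ring.
Qed.

Let inv_floor_le n d : (0 < d)%N -> (0 < n)%N -> (n %/ d).+1%:R^-1 <= d%:R / n%:R :> R.
Proof.
move=> d0 n0; rewrite -[leRHS]invrK lef_pV2 ?posrE ?ltr0n ?invr_gt0 ?divr_gt0 ?ltr0n//.
rewrite invf_div ler_pdivrMr ?ltr0n// -natrM ler_nat ltnW// ltn_ceil//.
Qed.

(* Since [ln] is the divisor sum of [Lambda], the sum of [chi(k) ln k / k] is that
   of [chi(d) Lambda(d) / d * harmonic_sum (n / d)]; replacing [n / d] by [n]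
   there costs [O(psi n / n)]. *)
Lemma harmonic_sum_mangoldt_sum_bound :
  exists C2, forall n, (0 < n)%N -> cabs (harmonic_sum n * mangoldt_sum n) <= C2.
Proof.
have [C1 hC1] := log_sum_bound; exists (C1 + B * 4) => n n0.
have n0r : 0 < n%:R :> R by rewrite ltr0n.
have -> : harmonic_sum n * mangoldt_sum n =
    \sum_(1 <= k < n.+1) chi k * (ln k%:R / k%:R)%:C +
    \sum_(1 <= d < n.+1) chi d * (Lam d / d%:R)%:C * (harmonic_sum n - harmonic_sum (n %/ d)).
  rewrite log_sumE -big_split/= /mangoldt_sum mulr_sumr; apply: eq_bigr => d _.
  by ring.
apply: le_trans (cabsD _ _) _; rewrite lerD//.
apply: le_trans (cabs_sum _ _ _) _.
apply: (@le_trans _ _ (\sum_(1 <= d < n.+1) Lam d * (B / n%:R))).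
  apply: ler_sum_nat => d /andP[d0 dn].
  have d0r : 0 < d%:R :> R by rewrite ltr0n.
  have t0 : 0 <= Lam d / d%:R by rewrite divr_ge0 ?vonmangoldt_ge0.
  rewrite !cabsM (cabs_real_ge0 t0).
  have h1 := harmonic_sum_dist (leq_div n d).
  have h2 : B / (n %/ d).+1%:R <= B * (d%:R / n%:R).
    by rewrite ler_wpM2l// inv_floor_le.
  apply: (@le_trans _ _ (1 * (Lam d / d%:R) * (B * (d%:R / n%:R)))).
    apply: ler_pM; [by apply: mulr_ge0; rewrite ?cabs_ge0|exact: cabs_ge0| |exact: le_trans h1 h2].
    exact: ler_wpM2r t0 _ _ (dchar_cabs_le d).
  by rewrite le_eqVlt; apply/orP; left; apply/eqP; field; rewrite !gt_eqF.
rewrite -mulr_suml -/(psi R n) mulrC -mulrA ler_wpM2l// mulrC ler_pdivrMr//.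
exact: psi_le.
Qed.

Let mangoldt_sum_le n : cabs (mangoldt_sum n) <= \sum_(1 <= d < n.+1) Lam d / d%:R.
Proof.
apply: le_trans (cabs_sum _ _ _) _; apply: ler_sum => d _.
have t0 : 0 <= Lam d / d%:R by rewrite divr_ge0 ?vonmangoldt_ge0.
by rewrite cabsM (cabs_real_ge0 t0) ler_piMl// dchar_cabs_le.
Qed.

(* The second alternative means that the [L]-function of [chi] vanishes at 1. *)
Lemma mangoldt_sum_bounded_or_harmonic_sum_small :
  (exists K, forall n, cabs (mangoldt_sum n) <= K) \/
  (forall n, (0 < n)%N -> cabs (harmonic_sum n) <= 2 * B / n%:R).
Proof.
have [h|] := pselect (forall n, (0 < n)%N -> cabs (harmonic_sum n) <= 2 * B / n%:R); first by right.
move=> /existsNP[x0 /not_implyP[x00 /negP]]; rewrite -ltNge => hx0; left.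
have [C2 hC2] := harmonic_sum_mangoldt_sum_bound.
have x0r : 0 < x0%:R :> R by rewrite ltr0n.
have B0 : 0 < B by rewrite ltr0n muln_gt0.
(* [harmonic_sum] has norm above [2 delta] at [x0] and moves by at most [delta] afterwards, so it
   stays above [delta] and can be divided out of the bounded product. *)
pose delta := B / x0%:R.
have d0 : 0 < delta by rewrite divr_gt0.
exists (Num.max (C2 / delta) (\sum_(1 <= d < x0.+1) Lam d / d%:R)) => n.
rewrite le_max; have [nx|xn] := leqP n x0.
  apply/orP; right; apply: le_trans (mangoldt_sum_le _) _.
  rewrite [leRHS](big_cat_nat (n := n.+1))//= lerDl sumr_ge0// => d _.
  by rewrite divr_ge0 ?vonmangoldt_ge0.
apply/orP; left; rewrite ler_pdivlMr// mulrC.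
apply: le_trans (hC2 n _); last exact: leq_trans xn.
rewrite cabsM ler_wpM2r ?cabs_ge0//.
have h1 : cabs (harmonic_sum n - harmonic_sum x0) <= delta.
  apply: le_trans (harmonic_sum_dist (ltnW xn)) _.
  by rewrite ler_wpM2l// lef_pV2 ?posrE ?ltr0n// ler_nat.
have h2 : cabs (harmonic_sum x0) <= cabs (harmonic_sum n) + cabs (harmonic_sum n - harmonic_sum x0).
  rewrite -[X in cabs X <= _](subKr (harmonic_sum n)).
  by apply: le_trans (cabsD _ _) _; rewrite cabsN.
by rewrite -mulrA -/delta in hx0; lra.
Qed.

(** The sum is the logarithm of [n ^ n / n!], a term of the exponential series at [n]. *)
Let sum_ln_quot n : (0 < n)%N ->
  \sum_(1 <= e < n.+1) (ln n%:R - ln e%:R) <= n%:R :> R.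
Proof.
move=> n0; have n0r : 0 < n%:R :> R by rewrite ltr0n.
rewrite sumrB sumr_const_nat subSS subn0.
have -> : \sum_(1 <= e < n.+1) ln e%:R = ln (n`!)%:R :> R.
  elim: (n) => [|k IH]; first by rewrite big_geq// ln1.
  by rewrite big_nat_recr//= IH factS natrM lnM ?posrE ?ltr0n ?fact_gt0// addrC.
have f0 : 0 < n`!%:R :> R by rewrite ltr0n fact_gt0.
have -> : ln n%:R *+ n - ln n`!%:R = ln (n%:R ^+ n / n`!%:R) :> R.
  by rewrite ln_div ?posrE ?exprn_gt0// lnXn.
rewrite -[leRHS]expRK ler_ln ?posrE ?expR_gt0 ?divr_gt0 ?exprn_gt0//.
case: (n) => [|k]; first by rewrite expr0 fact0 divr1 expR0.
by apply: le_trans (expR_ge1Dxn k _); rewrite ?lerDr.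
Qed.

(* Moebius inversion: the sum of [mu(e) chi(e) / e * ln (n / e) * harmonic_sum (n / e)]
   is [ln n + mangoldt_sum n]. *)
Lemma mangoldt_sum_ln_bound :
  (forall n, (0 < n)%N -> cabs (harmonic_sum n) <= 2 * B / n%:R) ->
  exists K, forall n, (0 < n)%N -> cabs ((ln n%:R)%:C + mangoldt_sum n) <= K.
Proof.
move=> small; exists (4 * B) => n n0.
have n0r : 0 < n%:R :> R by rewrite ltr0n.
have -> : (ln n%:R)%:C + mangoldt_sum n = \sum_(1 <= e < n.+1)
    (chi e * ((moebius e)%:~R / e%:R * (ln n%:R - ln e%:R))%:C) * harmonic_sum (n %/ e).
  under [RHS]eq_bigr do rewrite /harmonic_sum mulr_sumr.
  rewrite -(sum_dvd_exchange n (fun e k =>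
    (chi e * ((moebius e)%:~R / e%:R * (ln n%:R - ln e%:R))%:C) *
    (chi k * (k%:R^-1)%:C))).
  transitivity (\sum_(1 <= j < n.+1) chi j * (j%:R^-1)%:C *
      (ln n%:R * (j == 1)%N%:R + Lam j)%:C).
    under [RHS]eq_bigr do rewrite rmorphD mulrDr.
    rewrite big_split/=; congr (_ + _); last first.
      by apply: eq_bigr => j _; rewrite rmorphM/=; ring.
    rewrite big_ltn//= big_nat big1 => [|j /andP[j1 _]].
      by rewrite (dchar1 chiP) invr1 !mulr1 mul1r addr0.
    by rewrite gtn_eqF// mulr0 mulr0.
  apply: eq_big_nat => j /andP[j0 jn].
  have -> : ln n%:R * (j == 1)%N%:R + Lam j =
      \sum_(1 <= d < n.+1 | (d %| j)%N) (moebius d)%:~R * (ln n%:R - ln d%:R).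
    rewrite (big_divisors _ j0 (jn : (j <= n)%N)).
    under [RHS]eq_bigr do rewrite mulrBr.
    rewrite sumrB sum_moebius_ln// opprK -mulr_suml -rmorph_sum/= sum_moebius//.
    by rewrite rmorph_nat mulrC.
  rewrite rmorph_sum mulr_sumr/=; apply: eq_bigr => d dj.
  have := coefM d (j %/ d); rewrite mulnC divnK// => ->.
  by rewrite !rmorphM/=; ring.
apply: le_trans (cabs_sum _ _ _) _.
(* Since [n %/ e + 1 <= 2 (n %/ e)], smallness gives [4 B e / n] for [harmonic_sum (n %/ e)]; the
   [e] cancels [1 / e], and [sum_ln_quot] absorbs [1 / n]. *)
apply: (@le_trans _ _ (\sum_(1 <= e < n.+1) (ln n%:R - ln e%:R) * (4 * B / n%:R))).
  apply: ler_sum_nat => e /andP[e0 en].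
  have e0r : 0 < e%:R :> R by rewrite ltr0n.
  have l0 : 0 <= ln n%:R - ln e%:R :> R.
    by rewrite subr_ge0 ler_ln ?posrE ?ltr0n// ler_nat.
  have q0 : (0 < n %/ e)%N by rewrite divn_gt0.
  rewrite cabsM cabsM.
  apply: (@le_trans _ _ (1 * (e%:R^-1 * (ln n%:R - ln e%:R)) *
      (4 * B * (e%:R / n%:R)))); last first.
    by rewrite le_eqVlt; apply/orP; left; apply/eqP; field; rewrite !gt_eqF.
  rewrite ler_pM ?mulr_ge0 ?cabs_ge0//.
    rewrite ler_pM ?cabs_ge0 ?dchar_cabs_le// cabs_real normrM (ger0_norm l0) ler_wpM2r//.
    rewrite normrM [X in _ * X]ger0_norm ?invr_ge0// ler_piMl ?invr_ge0//.
    by have := moebius_norm e; rewrite -(ler_int R) intr_norm.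
  apply: le_trans (small _ q0) _.
  have -> : 4 * B * (e%:R / n%:R) = 2 * B * (2 * (e%:R / n%:R)) by ring.
  rewrite ler_wpM2l ?mulr_ge0//.
  apply: le_trans (_ : 2 * (n %/ e).+1%:R^-1 <= _); last by rewrite ler_wpM2l// inv_floor_le.
  rewrite ler_pdivlMr ?ltr0n// mulrC ler_pdivrMr ?ltr0n//.
  by rewrite -natrM ler_nat; lia.
rewrite -mulr_suml mulrA ler_pdivrMr// mulrC ler_wpM2l ?mulr_ge0//.
exact: sum_ln_quot.
Qed.

End CharacterSums.

(** * Exclusion of [L(1, chi) = 0] for nonprincipal characters *)

Section NonVanishing.
Variables (R : realType) (m : nat).
Hypothesis m0 : (0 < m)%N.
Local Notation Lam := (vonmangoldt R predT).

Definition nonprincipal (chi : nat -> R[i]) := exists2 a, coprime a m & chi a != 1.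

Lemma Re_mangoldt_sum (chi : nat -> R[i]) n : complex.Re (mangoldt_sum chi n) =
  \sum_(1 <= d < n.+1) complex.Re (chi d) * (Lam d / d%:R).
Proof.
have ReD : {morph (@complex.Re R) : z w / z + w} by move=> [a b] [c e].
rewrite /mangoldt_sum (big_morph _ ReD (erefl _)); apply: eq_bigr => d _.
by case: (chi d) => a b /=; rewrite mulr0 subr0.
Qed.

(** Both alternatives give an upper bound, since the second one is [- ln n + O(1)]. It can thus be
    applied to [chi ^ 2] before nonvanishing is known. *)
Lemma Re_mangoldt_sum_upper (chi : nat -> R[i]) : dchar m chi -> nonprincipal chi ->
  exists K, forall n, (0 < n)%N -> complex.Re (mangoldt_sum chi n) <= K.
Proof.
move=> chiP chi1; have [[K hK]|small] := mangoldt_sum_bounded_or_harmonic_sum_small m0 chiP chi1.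
  by exists K => n _; apply: le_trans (ler_norm _) (le_trans (normRe_le _) (hK n)).
have [K hK] := mangoldt_sum_ln_bound m0 chiP small; exists K => n n0.
have := le_trans (ler_norm _) (le_trans (normRe_le _) (hK n n0)).
case: (mangoldt_sum chi n) => a b /=; apply: le_trans.
by rewrite lerDr ln_nat_ge0.
Qed.

Lemma ln_nat_unbounded (K : R) : exists2 n, (0 < n)%N & K < ln n%:R.
Proof.
exists (Num.truncn (expR K)).+1 => //.
by rewrite -[ltLHS]expRK ltr_ln ?posrE ?expR_gt0// truncnS_gt.
Qed.

Lemma dchar_sqr (chi : nat -> R[i]) : dchar m chi -> dchar m (fun a => chi a ^+ 2).
Proof.
case=> chiM chim chin chi0; split=> [a b|a|a am|a am].
- by rewrite chiM exprMn.
- by rewrite chim.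
- by rewrite normrX chin// expr1n.
- by rewrite chi0// expr0n.
Qed.

(* The inequality [3 + 4 cos t + cos (2 t) >= 0]. *)
Lemma harmonic_sum_not_small_complex (chi : nat -> R[i]) :
  dchar m chi -> nonprincipal chi -> nonprincipal (fun a => chi a ^+ 2) ->
  ~ (forall n, (0 < n)%N -> cabs (harmonic_sum chi n) <= 2 * (2 * m)%:R / n%:R).
Proof.
move=> chiP chi1 chi2 small.
have [K hK] := mangoldt_sum_ln_bound m0 chiP small.
have [K2 hK2] := Re_mangoldt_sum_upper (dchar_sqr chiP) chi2.
(* The nonnegative combination [h0] is at most [3 (ln n + 4) + 4 (K - ln n) + K2], which forces
   [ln n <= 12 + 4 K + K2]. *)
have [n n0] := ln_nat_unbounded (12 + 4 * K + K2); apply/negP; rewrite -leNgt.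
have h0 : 0 <= 3 * (\sum_(1 <= d < n.+1) Lam d / d%:R) +
    4 * complex.Re (mangoldt_sum chi n) + complex.Re (mangoldt_sum (fun a => chi a ^+ 2) n).
  rewrite !Re_mangoldt_sum !mulr_sumr -!big_split/=; apply: sumr_ge0 => d _.
  have t0 : 0 <= Lam d / d%:R by rewrite divr_ge0 ?vonmangoldt_ge0.
  rewrite (_ : _ + _ = (3 + 4 * complex.Re (chi d) + complex.Re (chi d ^+ 2)) *
    (Lam d / d%:R)); last by ring.
  rewrite mulr_ge0//.
  have := dchar_cabs_le chiP d; rewrite /cabs normc_def/=.
  case: (chi d) => a b /= h.
  (* With [b ^ 2 <= 1 - a ^ 2] the factor [3 + 4 a + a ^ 2 - b ^ 2] is at least [2 (1 + a) ^ 2];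
     stated as an inequality this also covers [chi d = 0]. *)
  have {}h : a ^+ 2 + b ^+ 2 <= 1.
    rewrite -[leLHS]sqr_sqrtr ?addr_ge0 ?sqr_ge0//.
    by rewrite exprn_ile1// sqrtr_ge0.
  have := sqr_ge0 (1 + a); rewrite -!expr2; lra.
have h1 := sum_vonmangoldt_div_le R n0.
have h2 := hK2 n n0.
have := le_trans (ler_norm _) (le_trans (normRe_le _) (hK n n0)).
move: h0 h1 h2; move: (mangoldt_sum (fun a => chi a ^+ 2) n) => z.
case: (mangoldt_sum chi n) => a b /=.
move: (\sum_(_ <= _ < _) _) => S h0 h1 h2 h3; lra.
Qed.

Lemma harmonic_sum_not_small_real (chi : nat -> R[i]) :
  dchar m chi -> nonprincipal chi -> (forall a, coprime a m -> chi a ^+ 2 = 1) ->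
  ~ (forall n, (0 < n)%N -> cabs (harmonic_sum chi n) <= 2 * (2 * m)%:R / n%:R).
Proof.
move=> chiP chi1 chi2 small; pose X a := complex.Re (chi a).
have X3C a : [|| chi a == 0, chi a == 1 | chi a == -1].
  case: (boolP (coprime a m)) => am; last by case: chiP => _ _ _ ->; rewrite ?eqxx.
  by have /eqP := chi2 a am; rewrite sqrf_eq1 => ->; rewrite orbT.
have XE a : chi a = (X a)%:C.
  by apply/eqP; rewrite eq_complex /X; case/or3P: (X3C a) => /eqP ->; rewrite /= ?oppr0 !eqxx.
have X3 a : [|| X a == 0, X a == 1 | X a == -1].
  case/or3P: (X3C a) => /eqP e.
  - by rewrite (_ : X a = 0) ?eqxx// /X e.
  - by rewrite (_ : X a = 1) ?eqxx ?orbT// /X e.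
  - by rewrite (_ : X a = -1) ?eqxx ?orbT// /X e.
have X1 : X 1%N = 1 by rewrite /X (dchar1 chiP).
have XM a b : X (a * b)%N = X a * X b.
  by apply: complexI; rewrite rmorphM/= -!XE; case: chiP.
apply: (@real_char_sum_not_small R X (2 * m)%:R (2 * (2 * m)%:R) X1 XM X3) => [b|n n0].
  rewrite -cabs_real rmorph_sum/= cabs_le.
  by under eq_bigr do rewrite -XE; exact: dchar_sum_le.
apply: le_trans (small n n0); rewrite -cabs_real rmorph_sum/= /harmonic_sum.
by under [in leRHS]eq_bigr do rewrite XE -rmorphM/=.
Qed.

Lemma mangoldt_sum_bounded (chi : nat -> R[i]) : dchar m chi -> nonprincipal chi ->
  exists K, forall n, cabs (mangoldt_sum chi n) <= K.
Proof.
move=> chiP chi1; have [//|small] := mangoldt_sum_bounded_or_harmonic_sum_small m0 chiP chi1.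
exfalso; have [chi2|chi2] := pselect (nonprincipal (fun a => chi a ^+ 2)).
  exact: harmonic_sum_not_small_complex chiP chi1 chi2 small.
apply: harmonic_sum_not_small_real chiP chi1 _ small => a am.
by apply/eqP; apply: contra_notT chi2 => ca; exists a.
Qed.

End NonVanishing.

(** In the expansion of [f] in characters the nonprincipal ones sum to 0 over a period, so mean zero
    forces the coefficients of the principal ones to cancel; only bounded sums remain. *)
Lemma mertens_mean_zero (R : realType) (m : nat) (f : nat -> R[i]) : (0 < m)%N ->
  (forall a, f (a + m)%N = f a) -> (forall a, ~~ coprime a m -> f a = 0) ->
  \sum_(k < m) f k = 0 ->
  exists K, forall n, cabs (mangoldt_sum f n) <= K.
Proof.
case: m => // m' _; set m := m'.+1 => fm f0 fsum.
have m0 : (0 < m)%N by [].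
have [c [chi [chiP fE]]] := dchar_span fm f0.
pose np i := `[< nonprincipal m (chi i) >].
have chi_princ i a : ~~ np i -> chi i a = (coprime a m)%:R.
  move=> /asboolPn npi; case: (boolP (coprime a m)) => am /=.
    by apply/eqP; apply: contra_notT npi => ca; exists a.
  by case: (chiP i) => _ _ _ ->.
have {}fE a : f a = \sum_(i | np i) c i * chi i a.
  rewrite fE (bigID np)/= [X in _ + X](_ : _ = 0) ?addr0//.
  under eq_bigr => i npi do rewrite (chi_princ i a npi).
  rewrite -mulr_suml (_ : \sum_(i | ~~ np i) c i = 0) ?mul0r//.
  have : \sum_(k < m) (\sum_(i | np i) c i * chi i k +
                       \sum_(i | ~~ np i) c i * chi i k) = 0.
    by rewrite -[RHS]fsum; apply: eq_bigr => k _; rewrite fE [RHS](bigID np).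
  rewrite big_split/= exchange_big/= big1 ?add0r; last first.
    move=> i /asboolP npi; rewrite -mulr_sumr (dchar_sum_period m0 (chiP i) npi).
    by rewrite mulr0.
  under eq_bigr => k _.
    under eq_bigr => i npi do rewrite (chi_princ i k npi).
    rewrite -mulr_suml.
    over.
  rewrite -mulr_sumr => /eqP; rewrite mulf_eq0 => /orP[/eqP//|].
  rewrite -natr_sum pnatr_eq0 sum_nat_eq0 => /forallP/(_ (inord (1 %% m))).
  by rewrite /= inordK ?ltn_mod// coprime_modl coprime1n.
have hb i : exists K, np i -> forall n, cabs (mangoldt_sum (chi i) n) <= K.
  case: (boolP (np i)) => [/asboolP npi|_]; last by exists 0.
  by have [K hK] := mangoldt_sum_bounded m0 (chiP i) npi; exists K.
have [K hK] := choice hb.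
exists (\sum_(i | np i) cabs (c i) * K i) => n.
have -> : mangoldt_sum f n = \sum_(i | np i) c i * mangoldt_sum (chi i) n.
  rewrite /mangoldt_sum; under [RHS]eq_bigr do rewrite mulr_sumr.
  rewrite exchange_big/=; apply: eq_bigr => d _; rewrite fE mulr_suml.
  by apply: eq_bigr => i _; rewrite mulrA.
apply: le_trans (cabs_sum _ _ _) _; apply: ler_sum => i npi.
by rewrite cabsM ler_wpM2l ?cabs_ge0 ?hK.
Qed.

End ComplexSums.

(** * Residue classes *)

(** Either [m] has an odd prime factor or 4 divides [m]; in both cases one prime power contributes
    an even factor. *)
Lemma totient_even m : (3 <= m)%N -> ~~ odd (totient m).
Proof.
move=> m3; have m0 : (0 < m)%N by exact: leq_trans m3.
have pfactor_even p e k : prime p -> (0 < e)%N -> odd p || (1 < e)%N ->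
    coprime p k -> ~~ odd (totient (k * p ^ e)).
  move=> pp e0 pe pk; have p0 := prime_gt0 pp.
  rewrite totient_coprime ?coprimeXr//; last by rewrite coprime_sym.
  rewrite totient_pfactor// !oddM oddX.
  have -> : odd p.-1 = ~~ odd p by rewrite -[in RHS](prednK p0) /= negbK.
  by case: (odd p) pe => /= [_|e1]; rewrite ?andbF// orbF -subn1 subn_eq0 leqNgt e1 !andbF.
have [m' cm' mE] := pfactor_coprime (isT : prime 2) m0.
have [m'1|m'1] := eqVneq m' 1%N.
  rewrite mE m'1; have : (1 < logn 2 m)%N.
    by rewrite ltnNge; apply: contraTN m3 => v1; rewrite mE m'1; case: (logn 2 m) v1 => [|[]].
  by move=> v1; apply: pfactor_even => //; exact: ltnW.
have pp : prime (pdiv m').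
  rewrite pdiv_prime// ltn_neqAle eq_sym m'1/= lt0n.
  by apply: contraTneq m0 => m'0; rewrite mE m'0.
have pm : (pdiv m' %| m)%N by rewrite mE dvdn_mulr// pdiv_dvd.
have [k ck kE] := pfactor_coprime pp m0.
rewrite kE; apply: pfactor_even => //.
  by rewrite logn_gt0 mem_primes pp m0.
apply/orP; left; move: cm'; rewrite coprime2n; apply: contraLR => ep.
by rewrite -dvdn2; apply: dvdn_trans (pdiv_dvd m'); rewrite dvdn2.
Qed.

(** The selected classes as a [nat_pred], the form in which [pi]-parts are taken; nonprime members
    are harmless there. *)
Definition class_pred (m : nat) (H : {set 'I_m}) : nat_pred :=
  [pred p | [exists h in H, (h : nat) == (p %% m)%N]].

Lemma class_predP m (H : {set 'I_m}) (k : 'I_m) : ((k : nat) \in class_pred H) = (k \in H).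
Proof.
rewrite inE; apply/exists_inP/idP => [[h hH /eqP hk]|kH].
  by rewrite (_ : k = h)//; apply/val_inj; rewrite /= hk modn_small.
by exists k => //; rewrite modn_small.
Qed.

Lemma class_pred_modn m (H : {set 'I_m}) a :
  ((a %% m)%N \in class_pred H) = (a \in class_pred H).
Proof. by rewrite !inE modn_mod. Qed.

Lemma residue_primesP m (H : {set 'I_m}) (p : prime_nat) :
  residue_primes H p <-> (p : nat) \in class_pred H.
Proof.
split=> [[h /= hH [k _ /= hk]]|].
  rewrite inE; apply/exists_inP; exists h => //; apply/eqP.
  have /(congr1 (fun z => (z %% m%:Z)%Z)) := hk.
  rewrite addrC modzMDl !modz_nat => -[<-].
  by rewrite modn_small.
rewrite inE => /exists_inP[h hH /eqP hp]; exists h => //=.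
exists (p %/ m)%N%:Z => //=; rewrite hp.
by rewrite [in RHS](divn_eq p m) PoszD PoszM addrC.
Qed.

(** * Comparison of [n!] with its part in half of the residue classes *)

Section FactorialClassPart.
Variables (R : realType) (m : nat) (H : {set 'I_m}).
Hypothesis m3 : (3 <= m)%N.
Hypothesis Hco : forall h : 'I_m, h \in H -> coprime h m.
Hypothesis Hcard : #|H| = (totient m %/ 2)%N.

Local Notation Lam := (vonmangoldt R predT).
Let pi := class_pred H.

Let class_pred_coprime a : a \in pi -> coprime a m.
Proof.
rewrite inE => /exists_inP[h hH /eqP ha].
by rewrite -coprime_modl -ha Hco.
Qed.

(** 1 on the selected classes, -1 on the other units and 0 elsewhere; its mean is 0 because exactly
    half of the units are selected. *)
Let sgn (a : nat) : R := 2 * (a \in pi)%:R - (coprime a m)%:R.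

Let sgn_norm a : `|sgn a| <= 1.
Proof.
rewrite /sgn; case: (boolP (a \in pi)) => [/class_pred_coprime->|_] /=.
  by rewrite (_ : 2 * 1 - 1 = 1) ?normr1//; ring.
by rewrite mulr0 sub0r normrN; case: coprime; rewrite ?normr1 ?normr0.
Qed.

Let sgn_sum : \sum_(k < m) sgn k = 0.
Proof.
rewrite sumrB -mulr_sumr -!natr_sum.
have -> : (\sum_(k < m) ((k : nat) \in pi))%N = #|H|.
  rewrite -sum1_card [RHS]big_mkcond/=; apply: eq_bigr => k _.
  by rewrite class_predP; case: (k \in H).
have -> : (\sum_(k < m) coprime k m)%N = totient m.
  rewrite totient_count_coprime big_mkord; apply: eq_bigr => k _.
  by rewrite coprime_sym.
rewrite Hcard -natrM divn2 mul2n even_halfK ?subrr//.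
exact: totient_even.
Qed.

Let sgn_mertens : exists K : R, forall n,
  `|\sum_(1 <= d < n.+1) sgn d * (Lam d / d%:R)| <= K.
Proof.
have m0 : (0 < m)%N by exact: leq_trans m3.
have [|a am||K hK] := @mertens_mean_zero R m (fun a => (sgn a)%:C%C) m0.
- move=> a; rewrite /sgn -[(a + m)%N \in pi]class_pred_modn modnDr class_pred_modn.
  by rewrite -[coprime (a + m) m]coprime_modl modnDr coprime_modl.
- rewrite /sgn (negPf am) (_ : (a \in pi) = false) ?mulr0 ?subrr//.
  by apply: contraNF am; exact: class_pred_coprime.
- by rewrite -rmorph_sum/= sgn_sum.
exists K => n; rewrite -cabs_real rmorph_sum/=.
by under eq_bigr do rewrite rmorphM/=; exact: hK.
Qed.

(* [sgn d * Lam d] compensates [Lam d - 2 * vonmangoldt R pi d] up to the prime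
   powers [p ^ j] with [2 <= j] and the primes dividing [m]. *)
Let defect_le d : (0 < d)%N ->
  Lam d - 2 * vonmangoldt R pi d + sgn d * Lam d <=
  (if ~~ prime d then 2 * Lam d else 0) + (if (d <= m)%N then Lam d else 0).
Proof.
move=> d0; have L0 := vonmangoldt_ge0 R predT d.
have P0 := vonmangoldt_ge0 R pi d.
have if0 b : 0 <= (if b then Lam d else 0) :> R by case: b.
case: (boolP (prime d)) => pd /=; last first.
  have := if0 (d <= m)%N.
  have : sgn d * Lam d <= Lam d.
    by rewrite ler_piMl// (le_trans (ler_norm _)) ?sgn_norm.
  by move: (if _ then _ else _) => u; lra.
have LE pj : vonmangoldt R pj d = if d \in pj then ln d%:R else 0.
  by have := vonmangoldt_pX R pj 0 pd; rewrite expn1.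
rewrite /sgn (LE pi) add0r; case: (boolP (d \in pi)) => [dpi|dpi].
  by rewrite (class_pred_coprime dpi) LE/=; have := if0 (d <= m)%N; rewrite LE/=; lra.
case: (boolP (coprime d m)) => dm /=.
  by have := if0 (d <= m)%N; lra.
rewrite ifT; first by lra.
apply: dvdn_leq; first exact: leq_trans m3.
by rewrite -[(_ %| _)%N]negbK -prime_coprime.
Qed.

(** In logarithms, the excess is the sum of [(Lam d - 2 * vonmangoldt R pi d) (n %/ d)]. [defect_le]
    reduces it to [- n] times the Mertens sum of [sgn], up to terms of order [n]. *)
Lemma fact_le_class_part : exists2 C : R, 0 < C &
  forall n, n`!%:R <= C ^+ n * ((n`!)`_(class_pred H))%N%:R ^+ 2.
Proof.
have [K hK] := sgn_mertens.
pose c := \sum_(1 <= d < m.+1) Lam d / d%:R.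
(* [8] comes from twice the sum over proper prime powers, [c] from [d <= m], [K] from the Mertens
   sum of [sgn], and [4] from [psi n <= 4 n], the cost of rounding [n / d]. *)
pose T := 8 + c + K + 4.
exists (expR T); first exact: expR_gt0.
move=> n; have p0 : 0 < ((n`!)`_(class_pred H))%N%:R :> R by rewrite ltr0n part_gt0.
have f0 : 0 < n`!%:R :> R by rewrite ltr0n fact_gt0.
rewrite -ler_ln ?posrE ?mulr_gt0 ?exprn_gt0 ?expR_gt0//.
rewrite lnM ?posrE ?exprn_gt0 ?expR_gt0// !lnXn ?expR_gt0// expRK.
rewrite ln_fact ln_fact_partn -/pi -lerBlDr -mulr_natl mulr_sumr -sumrB.
have q1 d : (0 < d)%N -> (n %/ d)%:R <= n%:R / d%:R :> R.
  by move=> d0; rewrite ler_pdivlMr ?ltr0n// -natrM ler_nat leq_trunc_div.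
have q2 d : (0 < d)%N -> n%:R / d%:R - 1 <= (n %/ d)%:R :> R.
  move=> d0; rewrite lerBlDr ler_pdivrMr ?ltr0n// -(natrD _ _ 1) -natrM ler_nat addn1.
  by rewrite ltnW// ltn_ceil.
apply: (@le_trans _ _ (\sum_(1 <= d < n.+1) (
    (2 * (if ~~ prime d then Lam d / d%:R else 0) +
    (if (d <= m)%N then Lam d / d%:R else 0) - sgn d * (Lam d / d%:R)) * n%:R + Lam d))).
  apply: ler_sum_nat => d /andP[d0 _].
  have L0 := vonmangoldt_ge0 R predT d.
  have q0 : 0 <= (n %/ d)%:R :> R by [].
  have h1 := ler_wpM2r q0 (defect_le d0).
  have q1d := q1 d d0.
  have e1 : (2 * (if ~~ prime d then Lam d / d%:R else 0) +
      (if (d <= m)%N then Lam d / d%:R else 0)) * n%:R =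
      ((if ~~ prime d then 2 * Lam d else 0) + (if (d <= m)%N then Lam d else 0)) *
      (n%:R / d%:R).
    by case: prime; case: (d <= m)%N => /=; ring.
  have h2 : ((if ~~ prime d then 2 * Lam d else 0) + (if (d <= m)%N then Lam d else 0)) *
      (n %/ d)%:R <= ((if ~~ prime d then 2 * Lam d else 0) +
      (if (d <= m)%N then Lam d else 0)) * (n%:R / d%:R).
    by rewrite ler_wpM2l// addr_ge0//; case: ifP => // _; rewrite mulr_ge0.
  have h3 : sgn d * Lam d * (n%:R / d%:R - (n %/ d)%:R) <= Lam d.
    apply: le_trans (ler_norm _) _; rewrite !normrM (ger0_norm L0).
    rewrite [X in _ * X]ger0_norm ?subr_ge0//.
    have h : n%:R / d%:R - (n %/ d)%:R <= 1 :> R by have := q2 d d0; lra.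
    have := ler_pM (normr_ge0 (sgn d)) L0 (sgn_norm d) (lexx (Lam d)).
    rewrite mul1r => h4; rewrite -[leRHS]mulr1.
    by apply: ler_pM; rewrite ?mulr_ge0 ?subr_ge0.
  rewrite mulrBl e1.
  have -> : sgn d * (Lam d / d%:R) * n%:R = sgn d * Lam d * (n%:R / d%:R) by ring.
  by lra.
rewrite big_split/= -mulr_suml sumrB big_split/= -mulr_sumr.
have s1 := sum_vonmangoldt_nonprime_le R n; rewrite big_mkcond/= in s1.
have s2 : \sum_(1 <= d < n.+1) (if (d <= m)%N then Lam d / d%:R else 0) <= c.
  rewrite /c; have t0 d : 0 <= Lam d / d%:R by rewrite divr_ge0 ?vonmangoldt_ge0.
  rewrite -big_mkcond/=; have [nm|mn] := leqP n m.
    rewrite [leRHS](big_cat_nat (n := n.+1))//= ler_wpDr ?sumr_ge0//.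
    by rewrite big_mkcond/=; apply: ler_sum => d _; case: ifP.
  by rewrite -(big_nat_widen _ m.+1 n.+1 xpredT)//= ltnW.
have s3 := hK n; have s4 := psi_le R n; rewrite /psi in s4.
have n0 : 0 <= n%:R :> R by [].
rewrite -mulr_natr; apply: (@le_trans _ _ ((8 + c + K) * n%:R + 4 * n%:R)); last by rewrite /T; lra.
rewrite lerD// ler_wpM2r//.
by move: s3; rewrite ler_norml => /andP[s3 _]; lra.
Qed.

End FactorialClassPart.

(** * Choice of the constant and comparison of the two bounds *)

Theorem theorem5 (R : realType) :
  generalised_riemann_hypothesis R ->
  forall m : nat, (3 <= m)%N ->
  exists d : R, 0 < d /\
    forall H : {set 'I_m},
      (forall h : 'I_m, h \in H -> coprime h m) ->
      #|H| = (totient m %/ 2)%N ->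
    forall a b : int, b != 0 ->
    forall xi : int, xi != 0 ->
      4 * `|xi%:~R| *
        \big[*%R/1]_(p \in residue_primes H) (padic_abs_rat R p xi%:~R ^+ 2)
        < d ->
      exists2 p : prime_nat, residue_primes H p &
        linear_form a b (euler_series (xi%:~R : Qp R p)) != 0.
Proof.
move=> _ m m3.
(* The constant depends on [H]; summing over the finitely many [H], with the default 1 for
   inadmissible ones, yields a bound [c] depending only on [m]. *)
have hC (H : {set 'I_m}) : exists C : R, 0 < C /\
    ((forall h : 'I_m, h \in H -> coprime h m) -> #|H| = (totient m %/ 2)%N ->
    forall n, n`!%:R <= C ^+ n * ((n`!)`_(class_pred H))%N%:R ^+ 2).
  have [hco|nco] := pselect (forall h : 'I_m, h \in H -> coprime h m); last by exists 1.
  have [hcard|ncard] := pselect (#|H| = (totient m %/ 2)%N); last by exists 1.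
  by have [C C0 hC] := fact_le_class_part R m3 hco hcard; exists C.
have [C hC'] := choice hC.
pose c := \sum_(H : {set 'I_m}) C H.
have C0 H : 0 < C H by case: (hC' H).
have Cc H : C H <= c.
  by rewrite /c (bigD1 H)//= lerDl sumr_ge0// => K _; exact: ltW.
have c0 : 0 < c := lt_le_trans (C0 finset.set0) (Cc finset.set0).
(* With this choice the hypothesis reads [32 c |xi| < y] for [y] the square of the [R]-part of [xi]:
   [16 c |xi|] is the growth rate left after the factorials are compared, and the spare factor 2
   beats the constant [|a| + |b|]. *)
exists (8 * c)^-1; split; first by rewrite invr_gt0 mulr_gt0.
move=> H Hco Hcard a b b0 xi xi0.
rewrite (fsbig_padic_abs_sqr R xi0 (residue_primesP H)) => small.
apply: contrapT => none.
have zero (p : prime_nat) : (p : nat) \in class_pred H ->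
    linear_form a b (euler_series (xi%:~R : Qp R p)) = 0.
  move=> /residue_primesP pH; apply/eqP; apply: contra_notT none => nz.
  by exists p.
pose x : R := `|xi%:~R|; pose y : R := ((absz xi)`_(class_pred H))%N%:R ^+ 2.
have x0 : 0 < x by rewrite normr_gt0 intr_eq0.
have y0 : 0 < y by rewrite exprn_gt0// ltr0n part_gt0.
have {}small : 2 * (16 * c * x) < y.
  move: small; rewrite -/x -/y ltr_pdivrMr// [_^-1 * _]mulrC ltr_pdivlMr ?mulr_gt0//.
  by move=> small; lra.
(* Asking for [k >= |a| + |b|] ensures [2 ^ k > |a| + |b|], the final contradiction. *)
have [k kn hk] := part_le_pade_form b0 xi0 zero (absz a + absz b).
have := hC' H => -[_ /(_ Hco Hcard k) hf].
pose u : R := ((k`!)`_(class_pred H))%N%:R ^+ 2.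
have u0 : 0 < u by rewrite exprn_gt0// ltr0n part_gt0.
pose N : R := (absz a + absz b)%:R.
have N0 : 0 <= N by [].
have hk' : u * y ^+ k <= N * (16 ^+ k * k`!%:R * x ^+ k).
  move: hk; rewrite -(ler_nat R) !natrM !natrX.
  by rewrite (_ : (absz xi)%:R = x)// natr_absz intr_norm.
have h1 : y ^+ k <= N * (16 * c * x) ^+ k.
  rewrite -(ler_pM2l u0); apply: le_trans hk' _.
  have -> : u * (N * (16 * c * x) ^+ k) = N * (16 ^+ k * (c ^+ k * u) * x ^+ k).
    by rewrite !exprMn; ring.
  rewrite ler_wpM2l// ler_wpM2r ?exprn_ge0 ?(ltW x0)// ler_wpM2l ?exprn_ge0//.
  apply: le_trans hf _; rewrite ler_wpM2r ?(ltW u0)//.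
  by rewrite lerXn2r ?nnegrE ?(ltW c0) ?(ltW (C0 H)).
have z0 : 0 < 16 * c * x by rewrite !mulr_gt0.
have h2 : (2 * (16 * c * x)) ^+ k <= y ^+ k.
  by rewrite lerXn2r ?nnegrE ?(ltW y0) ?(ltW small)// mulr_ge0// ltW.
have := le_trans h2 h1; rewrite exprMn ler_pM2r ?exprn_gt0// -natrX ler_nat.
by rewrite leqNgt (leq_ltn_trans kn (ltn_expl _ _)).
Qed.
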